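(* Let $X$ be a real Banach space and let $K \subset X$ be a weakly closed set. Then $K$ is super weakly compact if and only if there exist a reflexive Banach space $Z$ and a super weakly compact operator $T: Z \rightarrow X$ such that $K \subset T(B_Z)$.
   Context: Banach spaces are real; $B_Z$ is the closed unit ball of $Z$. For a Banach space $X$, an infinite set $I$ and a free ultrafilter $\mathcal U$ on $I$, let $\ell_\infty(X)$ be the space of bounded families $(x_i)_{i\in I}$ in $X$ with the sup norm, and let the ultrapower $X^{\mathcal U}$ be the quotient of $\ell_\infty(X)$ by the subspace of families with $\lim_{i,\mathcal U}\|x_i\|=0$. For $A\subset X$, $A^{\mathcal U}$ is the set of classes in $X^{\mathcal U}$ of bounded families $(x_i)_{i\in I}$ with $x_i\in A$ for all $i$. A weakly closed subset $K\subset X$ is super weakly compact (SWC) if $K^{\mathcal U}$ is a relatively weakly compact subset of $X^{\mathcal U}$ for every free ultrafilter $\mathcal U$. A bounded linear operator $T:Z\to X$ induces $T^{\mathcal U}:Z^{\mathcal U}\to X^{\mathcal U}$ by $T^{\mathcal U}((z_i)_i)=(T(z_i))_i$; $T$ is called super weakly compact if $T^{\mathcal U}$ is a weakly compact operator for every free ultrafilter $\mathcal U$. *)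

(* Defs.v *)
From HB Require Import structures.
From mathcomp Require Import all_boot all_order all_algebra.
From mathcomp Require Import generic_quotient ring_quotient.
From mathcomp Require Import all_classical all_reals all_analysis.

Set Implicit Arguments.
Unset Strict Implicit.
Unset Printing Implicit Defensive.

Import Order.TTheory GRing.Theory Num.Theory.
Import numFieldNormedType.Exports.

Local Open Scope classical_set_scope.
Local Open Scope ring_scope.
Local Open Scope quotient_scope.

Definition unit_ball {R : realType} (Z : normedModType R) : set Z :=
  [set z | `|z| <= 1].
Arguments unit_ball {R} Z.

Section BoundedOperators.
Context {R : realType} (Z X : normedModType R).

Definition bounded_operator_pred : {pred Z -> X} :=
  fun T => `[< linear T /\ continuous T >].

Lemma bounded_operator_pred_subsemimod :
  GRing.subsemimod_closed bounded_operator_pred.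
Proof.
split; [split|].
- apply/asboolP; split; first by move=> a x y /=; rewrite scaler0 addr0.
  by move=> x; exact: cvg_cst.
- move=> S T /asboolP[lS cS] /asboolP[lT cT]; apply/asboolP; split.
    move=> a x y; rewrite -[(S + T) _]/(S _ + T _) lS lT.
    by rewrite addrACA -scalerDr.
  by move=> x; apply: cvgD; [exact: cS|exact: cT].
- move=> a T /asboolP[lT cT]; apply/asboolP; split.
    move=> b x y; rewrite -[(a *: T) _]/(a *: T _) lT scalerDr !scalerA.
    by rewrite [a * b]mulrC -scalerA.
  by move=> x; apply: cvgZr; exact: cT.
Qed.

Lemma bounded_operator_pred_oppr : oppr_closed bounded_operator_pred.
Proof.
move=> T hT; rewrite -scaleN1r.
exact: (bounded_operator_pred_subsemimod).2.
Qed.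

HB.instance Definition _ := GRing.isAddClosed.Build (Z -> X)
  bounded_operator_pred bounded_operator_pred_subsemimod.1.
HB.instance Definition _ := GRing.isOppClosed.Build (Z -> X)
  bounded_operator_pred bounded_operator_pred_oppr.
HB.instance Definition _ := GRing.isScaleClosed.Build R (Z -> X)
  bounded_operator_pred bounded_operator_pred_subsemimod.2.

Record bounded_operator := BoundedOperator {
  bounded_operator_fun :> Z -> X ;
  _ : bounded_operator_fun \in bounded_operator_pred }.

HB.instance Definition _ := [isSub for bounded_operator_fun].
HB.instance Definition _ := [Choice of bounded_operator by <:].
HB.instance Definition _ := [SubChoice_isSubLmodule of bounded_operator by <:].

Implicit Types S T : bounded_operator.

Lemma bounded_operator_linear T : linear T.
Proof. by case: T => T /= /asboolP[]. Qed.

HB.instance Definition _ T := GRing.isLinear.Build R Z X *:%R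
  (bounded_operator_fun T) (bounded_operator_linear T).

Lemma bounded_operator_continuous T : continuous T.
Proof. by case: T => T /= /asboolP[]. Qed.

Lemma bounded_operator_bound T :
  exists2 M, 0 <= M & forall z, `|T z| <= M * `|z|.
Proof.
have cT : continuous T := @bounded_operator_continuous T.
move/linear_bounded_continuous/linear_boundedP : cT.
by move=> /pinfty_ex_gt0[M M0 TM]; exists M => //; exact: ltW.
Qed.

Definition operator_norm T : R := sup [set `|T z| | z in unit_ball Z].

Lemma operator_norm_has_sup T : has_sup [set `|T z| | z in unit_ball Z].
Proof.
split; first by exists `|T 0|, 0 => //; rewrite /unit_ball /= normr0.
have [M M0 TM] := bounded_operator_bound T.
exists M => _ [z z1 <-]; apply: le_trans (TM z) _.
by rewrite -[leRHS]mulr1 ler_wpM2l.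
Qed.

Lemma operator_norm_ub T z : z \in unit_ball Z -> `|T z| <= operator_norm T.
Proof.
rewrite inE => z1; apply: sup_upper_bound; first exact: operator_norm_has_sup.
by exists z.
Qed.

Lemma operator_norm_lub T M : (forall z, `|z| <= 1 -> `|T z| <= M) ->
  operator_norm T <= M.
Proof.
move=> TM; apply: ge_sup; first exact: (operator_norm_has_sup T).1.
by move=> _ [z z1 <-]; exact: TM.
Qed.

Lemma operator_norm_ge0 T : 0 <= operator_norm T.
Proof.
apply: le_trans (@operator_norm_ub T 0 _); first exact: normr_ge0.
by rewrite inE /unit_ball /= normr0.
Qed.

Lemma operator_normP T z : `|T z| <= operator_norm T * `|z|.
Proof.
have [->|z0] := eqVneq z 0; first by rewrite linear0 !normr0 mulr0.
have nz : 0 < `|z| by rewrite normr_gt0.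
rewrite -ler_pdivrMr// mulrC -[X in X * _]gtr0_norm ?invr_gt0//.
rewrite -normrZ -linearZ; apply: operator_norm_ub.
by rewrite inE /unit_ball /= normrZ normfV normr_id mulVf// gt_eqF.
Qed.

Lemma operator_norm_triangle S T :
  operator_norm (S + T) <= operator_norm S + operator_norm T.
Proof.
apply: operator_norm_lub => z z1; apply: le_trans (ler_normD _ _) _.
by apply: lerD; apply: operator_norm_ub; rewrite inE.
Qed.

Lemma operator_normZ_le a T : operator_norm (a *: T) <= `|a| * operator_norm T.
Proof.
apply: operator_norm_lub => z z1; rewrite -[(a *: T) z]/(a *: T z) normrZ.
by rewrite ler_wpM2l// operator_norm_ub// inE.
Qed.

Lemma operator_normZ a T : operator_norm (a *: T) = `|a| * operator_norm T.
Proof.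
apply/le_anti/andP; split; first exact: operator_normZ_le.
have [->|a0] := eqVneq a 0; first by rewrite normr0 mul0r operator_norm_ge0.
rewrite -ler_pdivlMl ?normr_gt0// -normfV.
by rewrite -{1}[T](scalerK a0) operator_normZ_le.
Qed.

Lemma operator_norm_eq0 T : operator_norm T = 0 -> T = 0.
Proof.
move=> T0; apply/val_inj/funext => z; apply/eqP.
by rewrite -normr_le0 (le_trans (operator_normP T z))// T0 mul0r.
Qed.

HB.instance Definition _ := Lmodule_isNormed.Build R bounded_operator
  operator_norm_triangle operator_normZ operator_norm_eq0.

End BoundedOperators.

Definition mk_bounded_operator {R : realType} (Z X : normedModType R)
    (T : Z -> X) (lT : linear T) (cT : continuous T) : bounded_operator Z X :=
  BoundedOperator (introT (asboolP _) (conj lT cT)).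

Lemma bound_continuous {R : realType} (Z X : normedModType R) (T : Z -> X) M :
  linear T -> (forall z, `|T z| <= M * `|z|) -> continuous T.
Proof.
move=> lT TM.
pose T' : {linear Z -> X} := HB.pack T (GRing.isLinear.Build _ _ _ _ _ lT).
apply: (@bounded_linear_continuous _ _ _ T'); apply/linear_boundedP.
near=> r => z; apply: le_trans (TM z) _; by rewrite ler_wpM2r.
Unshelve. all: by end_near. Qed.

Definition dual {R : realType} (X : normedModType R) : normedModType R :=
  bounded_operator X R.

Section Bidual.
Context {R : realType} (X : normedModType R).

Definition evaluation (x : X) : dual X -> R := fun f => f x.

Lemma evaluation_linear x : linear (evaluation x).
Proof. by []. Qed.

Lemma evaluation_continuous x : continuous (evaluation x).
Proof.
apply: (bound_continuous (M := `|x|) (evaluation_linear x)) => f.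
by rewrite mulrC; exact: operator_normP.
Qed.

Definition canonical_embedding (x : X) : dual (dual X) :=
  mk_bounded_operator (evaluation_linear x) (@evaluation_continuous x).

Definition reflexive_space := range canonical_embedding = setT.

End Bidual.

(* The carrier of [X] with the coarsest topology making every [f : dual X]
   continuous; [X] itself keeps the norm topology. *)
Definition weak {R : realType} (X : normedModType R) : Type := X.

HB.instance Definition _ {R : realType} (X : normedModType R) :=
  Topological.copy (weak X)
    (sup_topology (fun f : dual X =>
      Topological.class (initial_topology (f : X -> R)))).

Definition weakly_closed {R : realType} (X : normedModType R) (A : set X) :=
  closed (A : set (weak X)).

Definition relatively_weakly_compact {R : realType} (X : normedModType R)
    (A : set X) :=
  precompact (A : set (weak X)).

Definition weakly_compact_operator {R : realType} (Z X : normedModType R)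
    (T : bounded_operator Z X) :=
  relatively_weakly_compact (T @` unit_ball Z).

Section BoundedFamilies.
Context (I : Type) {R : realType} (X : normedModType R).

Definition bounded_family_pred : {pred I -> X} := fun x => `[< bounded_fun x >].

Lemma bounded_familyP (x : I -> X) :
  bounded_fun x <-> exists M, forall i, `|x i| <= M.
Proof.
split=> [/pinfty_ex_gt0[M _ xM]|[M xM]].
  by exists M => i; exact: xM.
rewrite /= /bounded_near; near=> r => i _; exact: le_trans (xM i) _.
Unshelve. all: by end_near. Qed.

Lemma bounded_family_pred_subsemimod :
  GRing.subsemimod_closed bounded_family_pred.
Proof.
split; [split|].
- by apply/asboolP/bounded_familyP; exists 0 => i /=; rewrite normr0.
- move=> x y /asboolP/bounded_familyP[M xM] /asboolP/bounded_familyP[N yN].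
  apply/asboolP/bounded_familyP; exists (M + N) => i.
  by apply: le_trans (ler_normD _ _) _; exact: lerD.
- move=> a x /asboolP/bounded_familyP[M xM].
  apply/asboolP/bounded_familyP; exists (`|a| * M) => i.
  by rewrite -[(a *: x) i]/(a *: x i) normrZ ler_wpM2l.
Qed.

Lemma bounded_family_pred_oppr : oppr_closed bounded_family_pred.
Proof.
move=> T hT; rewrite -scaleN1r.
exact: (bounded_family_pred_subsemimod).2.
Qed.

HB.instance Definition _ := GRing.isAddClosed.Build (I -> X)
  bounded_family_pred bounded_family_pred_subsemimod.1.
HB.instance Definition _ := GRing.isOppClosed.Build (I -> X)
  bounded_family_pred bounded_family_pred_oppr.
HB.instance Definition _ := GRing.isScaleClosed.Build R (I -> X)
  bounded_family_pred bounded_family_pred_subsemimod.2.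

Record bounded_family := BoundedFamily {
  bounded_family_fun :> I -> X ;
  _ : bounded_family_fun \in bounded_family_pred }.

HB.instance Definition _ := [isSub for bounded_family_fun].
HB.instance Definition _ := [Choice of bounded_family by <:].
HB.instance Definition _ := [SubChoice_isSubLmodule of bounded_family by <:].

Implicit Types x y : bounded_family.

Lemma bounded_family_bound x : exists M, forall i, `|x i| <= M.
Proof. by case: x => x /= /asboolP/bounded_familyP. Qed.

(* If [I] is empty, the supremum is [sup set0 = 0], the norm of the only family *)
Definition sup_norm x : R := sup (range (fun i => `|x i|)).

Lemma sup_norm_ub x i : `|x i| <= sup_norm x.
Proof.
apply: sup_upper_bound; last by exists i.
split; first by exists `|x i|, i.
by have [M xM] := bounded_family_bound x; exists M => _ [j _ <-].
Qed.

Lemma sup_norm_lub x M : 0 <= M -> (forall i, `|x i| <= M) -> sup_norm x <= M.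
Proof.
move=> M0 xM; have [[i _]|nI] := pselect (exists i : I, True).
  by apply: ge_sup; [exists `|x i|, i|move=> _ [j _ <-]].
rewrite /sup_norm (_ : [set _ | _ in _] = set0) ?sup0//.
by rewrite -subset0 => ? [i _ _]; apply: nI; exists i.
Qed.

Lemma sup_norm_ge0 x : 0 <= sup_norm x.
Proof.
have [[i _]|nI] := pselect (exists i : I, True).
  exact: le_trans (sup_norm_ub x i).
rewrite /sup_norm (_ : [set _ | _ in _] = set0) ?sup0//.
by rewrite -subset0 => ? [i _ _]; apply: nI; exists i.
Qed.

Lemma sup_norm_triangle x y : sup_norm (x + y) <= sup_norm x + sup_norm y.
Proof.
apply: sup_norm_lub => [|i]; first by rewrite addr_ge0 ?sup_norm_ge0.
by apply: le_trans (ler_normD _ _) _; apply: lerD; exact: sup_norm_ub.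
Qed.

Lemma sup_normZ_le a x : sup_norm (a *: x) <= `|a| * sup_norm x.
Proof.
apply: sup_norm_lub => [|i]; first by rewrite mulr_ge0 ?sup_norm_ge0.
by rewrite -[(a *: x) i]/(a *: x i) normrZ ler_wpM2l// sup_norm_ub.
Qed.

Lemma sup_normZ a x : sup_norm (a *: x) = `|a| * sup_norm x.
Proof.
apply/le_anti/andP; split; first exact: sup_normZ_le.
have [->|a0] := eqVneq a 0; first by rewrite normr0 mul0r sup_norm_ge0.
rewrite -ler_pdivlMl ?normr_gt0// -normfV.
by rewrite -{1}[x](scalerK a0) sup_normZ_le.
Qed.

Lemma sup_norm_eq0 x : sup_norm x = 0 -> x = 0.
Proof.
move=> x0; apply/val_inj/funext => i; apply/eqP.
by rewrite -normr_le0 -x0; exact: sup_norm_ub.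
Qed.

HB.instance Definition _ := Lmodule_isNormed.Build R bounded_family
  sup_norm_triangle sup_normZ sup_norm_eq0.

End BoundedFamilies.

Record free_ultrafilter (I : Type) := FreeUltrafilter {
  ultra_sets :> set_system I ;
  ultra_sets_ultra : UltraFilter ultra_sets ;
  _ : \bigcap_(A in ultra_sets) A = set0 }.

#[global] Existing Instance ultra_sets_ultra.

Section Ultrapower.
Context (I : Type) (U : free_ultrafilter I) {R : realType} (X : normedModType R).

Local Notation family := (bounded_family I X).

Definition null_families : {pred family} :=
  fun x => `[< (fun i => `|x i|) @ ultra_sets U --> (0 : R) >].

Lemma null_familyP (x : family) : reflect
  (forall e, 0 < e -> \forall i \near ultra_sets U, `|x i| < e) (x \in null_families).
Proof.
apply: (iffP (asboolP _)) => [/cvgrPdist_lt x0 e e0|x0].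
  have := x0 e e0; apply: filterS => i.
  by rewrite sub0r normrN normr_id.
apply/cvgrPdist_lt => e e0; have := x0 e e0; apply: filterS => i.
by rewrite sub0r normrN normr_id.
Qed.

Lemma null_families_subsemimod : GRing.subsemimod_closed null_families.
Proof.
split; [split|].
- by apply/null_familyP => e e0; apply: nearW => i; rewrite normr0.
- move=> x y /null_familyP x0 /null_familyP y0; apply/null_familyP => e e0.
  have e2 : 0 < e / 2 by rewrite divr_gt0.
  apply: filterS2 (x0 _ e2) (y0 _ e2) => i xi yi.
  by apply: le_lt_trans (ler_normD _ _) _; rewrite [e]splitr ltrD.
- move=> a x /null_familyP x0; apply/null_familyP => e e0.
  have a1 : 0 < `|a| + 1 by rewrite ltr_wpDl.
  have ea : 0 < e / (`|a| + 1) by rewrite divr_gt0.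
  apply: filterS (x0 _ ea) => i.
  rewrite ltr_pdivlMr//; apply: le_lt_trans.
  by rewrite -[(a *: x) i]/(a *: x i) normrZ mulrC ler_wpM2l// lerDl.
Qed.

Lemma null_families_oppr : oppr_closed null_families.
Proof.
move=> T hT; rewrite -scaleN1r.
exact: (null_families_subsemimod).2.
Qed.

HB.instance Definition _ := GRing.isAddClosed.Build family
  null_families null_families_subsemimod.1.
HB.instance Definition _ := GRing.isOppClosed.Build family
  null_families null_families_oppr.
HB.instance Definition _ := GRing.isScaleClosed.Build R family
  null_families null_families_subsemimod.2.

(* [{ideal_quot _}] only needs an additive subgroup; scalars are added below. *)
Definition ultrapower : Type := {ideal_quot null_families}.

HB.instance Definition _ := GRing.Zmodule.on ultrapower.

Definition ultraclass (x : family) : ultrapower :=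
  \pi_{ideal_quot null_families} x.

Definition ultrarepr (c : ultrapower) : family :=
  repr (c : {ideal_quot null_families}).

Lemma ultrareprK : cancel ultrarepr ultraclass.
Proof. exact: reprK. Qed.

Lemma ultraclass_eq x y : ultraclass x = ultraclass y <-> x - y \in null_families.
Proof.
by rewrite [x - y \in _]Quotient.idealrBE; split => [|] /eqP.
Qed.

Lemma ultraclassD : {morph ultraclass : x y / x + y}.
Proof. by move=> x y; rewrite /ultraclass piE. Qed.

Definition ultrapower_scale (a : R) (c : ultrapower) : ultrapower :=
  ultraclass (a *: ultrarepr c).

Lemma ultrapower_scaleE a x :
  ultrapower_scale a (ultraclass x) = ultraclass (a *: x).
Proof.
apply/ultraclass_eq; rewrite -scalerBr rpredZ//.
by apply/ultraclass_eq; rewrite ultrareprK.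
Qed.

Lemma ultrapower_scaleA a b c :
  ultrapower_scale a (ultrapower_scale b c) = ultrapower_scale (a * b) c.
Proof. by rewrite -[c]ultrareprK !ultrapower_scaleE scalerA. Qed.

Lemma ultrapower_scale1 : left_id 1 ultrapower_scale.
Proof. by move=> c; rewrite -[c]ultrareprK !ultrapower_scaleE scale1r. Qed.

Lemma ultrapower_scaleDr : right_distributive ultrapower_scale +%R.
Proof.
move=> a c d; rewrite -[c]ultrareprK -[d]ultrareprK -ultraclassD.
by rewrite !ultrapower_scaleE scalerDr ultraclassD.
Qed.

Lemma ultrapower_scaleDl c : {morph ultrapower_scale^~ c : a b / a + b}.
Proof.
move=> a b; rewrite -[c]ultrareprK !ultrapower_scaleE scalerDl.
by rewrite ultraclassD.
Qed.

HB.instance Definition _ := GRing.Zmodule_isLmodule.Build R ultrapower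
  ultrapower_scaleA ultrapower_scale1 ultrapower_scaleDr ultrapower_scaleDl.

Lemma ultraclass_linear : linear ultraclass.
Proof.
by move=> a x y; rewrite ultraclassD -ultrapower_scaleE.
Qed.

HB.instance Definition _ := GRing.isLinear.Build R family ultrapower *:%R
  ultraclass ultraclass_linear.

Definition quotient_norm (c : ultrapower) : R :=
  inf [set `|x| | x in [set x : family | ultraclass x = c]].

Lemma quotient_norm_has_inf c :
  has_inf [set `|x| | x in [set x : family | ultraclass x = c]].
Proof.
split; last by exists 0 => _ [x _ <-].
by exists `|ultrarepr c|, (ultrarepr c) => //=; exact: ultrareprK.
Qed.

Lemma quotient_norm_lb x : quotient_norm (ultraclass x) <= `|x|.
Proof.
by apply: ge_inf; [exact: (quotient_norm_has_inf _).2|exists x].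
Qed.

Lemma quotient_norm_glb c M : (forall x, ultraclass x = c -> M <= `|x|) ->
  M <= quotient_norm c.
Proof.
move=> cM; apply: lb_le_inf; first exact: (quotient_norm_has_inf c).1.
by move=> _ [x xc <-]; exact: cM.
Qed.

Lemma quotient_norm_ge0 c : 0 <= quotient_norm c.
Proof. exact: quotient_norm_glb. Qed.

Lemma quotient_norm_adherent c e : 0 < e ->
  exists2 x, ultraclass x = c & `|x| < quotient_norm c + e.
Proof.
move=> e0; have [_ [x xc <-] xe] := inf_adherent e0 (quotient_norm_has_inf c).
by exists x.
Qed.

Lemma quotient_norm_triangle c d :
  quotient_norm (c + d) <= quotient_norm c + quotient_norm d.
Proof.
rewrite -lerBlDr; apply: quotient_norm_glb => x xc.
rewrite lerBlDr -lerBlDl; apply: quotient_norm_glb => y yd.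
rewrite lerBlDl -xc -yd -ultraclassD.
exact: le_trans (quotient_norm_lb _) (ler_normD _ _).
Qed.

Lemma quotient_normZ_le a c : quotient_norm (a *: c) <= `|a| * quotient_norm c.
Proof.
have [->|a0] := eqVneq a 0.
  rewrite normr0 mul0r scale0r -(linear0 ultraclass).
  by apply: le_trans (quotient_norm_lb _) _; rewrite normr0.
rewrite -ler_pdivrMl ?normr_gt0//; apply: quotient_norm_glb => x <-.
rewrite ler_pdivrMl ?normr_gt0// -linearZ/= -normrZ.
exact: quotient_norm_lb.
Qed.

Lemma quotient_normZ a c : quotient_norm (a *: c) = `|a| * quotient_norm c.
Proof.
apply/le_anti/andP; split; first exact: quotient_normZ_le.
have [->|a0] := eqVneq a 0; first by rewrite normr0 mul0r quotient_norm_ge0.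
rewrite -ler_pdivlMl ?normr_gt0// -normfV.
by rewrite -{1}[c](scalerK a0) quotient_normZ_le.
Qed.

Lemma quotient_norm_eq0 c : quotient_norm c = 0 -> c = 0.
Proof.
move=> c0; rewrite -[c]ultrareprK -(linear0 ultraclass).
apply/ultraclass_eq; rewrite subr0; apply/null_familyP => e e0.
have e2 : 0 < e / 2 by rewrite divr_gt0.
have [x xc xe] := quotient_norm_adherent c e2.
have : ultrarepr c - x \in null_families.
  by apply/ultraclass_eq; rewrite ultrareprK.
move=> /null_familyP/(_ _ e2); apply: filterS => i cxi.
rewrite -[ultrarepr c](subrK x); apply: le_lt_trans (ler_normD _ _) _.
rewrite [e]splitr ltrD//; apply: le_lt_trans (sup_norm_ub x i) _.
by rewrite c0 add0r in xe.
Qed.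

HB.instance Definition _ := Lmodule_isNormed.Build R ultrapower
  quotient_norm_triangle quotient_normZ quotient_norm_eq0.

Definition set_ultrapower (A : set X) : set ultrapower :=
  [set ultraclass x | x in [set x : family | forall i, A (x i)]].

End Ultrapower.

Arguments null_families {I} U {R} X.
Arguments set_ultrapower {I} U {R X} A.

Section OperatorUltrapower.
Context (I : Type) (U : free_ultrafilter I) {R : realType}.
Context (Z X : normedModType R) (T : bounded_operator Z X).

Lemma map_family_subproof (z : bounded_family I Z) :
  T \o z \in @bounded_family_pred I R X.
Proof.
apply/asboolP/bounded_familyP; exists (operator_norm T * `|z|) => i /=.
apply: le_trans (operator_normP T (z i)) _.
by rewrite ler_wpM2l ?operator_norm_ge0//; exact: sup_norm_ub.
Qed.

Definition map_family (z : bounded_family I Z) : bounded_family I X :=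
  BoundedFamily (map_family_subproof z).

Lemma map_family_linear : linear map_family.
Proof. by move=> a x y; apply/val_inj/funext => i /=; rewrite linearP. Qed.

HB.instance Definition _ := GRing.isLinear.Build R _ _ *:%R
  map_family map_family_linear.

Lemma map_family_norm z : `|map_family z| <= operator_norm T * `|z|.
Proof.
apply: sup_norm_lub => [|i]; first by rewrite mulr_ge0 ?operator_norm_ge0.
apply: le_trans (operator_normP T (z i)) _.
by rewrite ler_wpM2l ?operator_norm_ge0//; exact: sup_norm_ub.
Qed.

Lemma map_family_null (z : bounded_family I Z) :
  z \in null_families U Z -> map_family z \in null_families U X.
Proof.
move=> /null_familyP z0; apply/null_familyP => e e0.
have a1 : 0 < operator_norm T + 1 by rewrite ltr_wpDl ?operator_norm_ge0.
have ea : 0 < e / (operator_norm T + 1) by rewrite divr_gt0.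
apply: filterS (z0 _ ea) => i; rewrite ltr_pdivlMr// mulrC; apply: le_lt_trans.
by apply: le_trans (operator_normP T (z i)) _; rewrite ler_wpM2r// lerDl.
Qed.

Definition ultrapower_map (c : ultrapower U Z) : ultrapower U X :=
  ultraclass U (map_family (ultrarepr c)).

Lemma ultrapower_mapE z :
  ultrapower_map (ultraclass U z) = ultraclass U (map_family z).
Proof.
apply/ultraclass_eq; rewrite -linearB; apply: map_family_null.
by apply/ultraclass_eq; rewrite ultrareprK.
Qed.

Lemma ultrapower_map_linear : linear ultrapower_map.
Proof.
move=> a c d; rewrite -[c]ultrareprK -[d]ultrareprK -linearP.
by rewrite !ultrapower_mapE !linearP.
Qed.

Lemma ultrapower_map_continuous : continuous ultrapower_map.
Proof.
apply: (bound_continuous (M := operator_norm T) ultrapower_map_linear) => c.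
have T0 := operator_norm_ge0 T.
have [T1|T1] := eqVneq (operator_norm T) 0.
  rewrite -[c]ultrareprK ultrapower_mapE.
  apply: le_trans (quotient_norm_lb _ _) _.
  by apply: le_trans (map_family_norm _) _; rewrite T1 !mul0r.
have Tgt0 : 0 < operator_norm T by rewrite lt_neqAle eq_sym T1.
rewrite -ler_pdivrMl//; apply: quotient_norm_glb => z <-.
rewrite ler_pdivrMl// ultrapower_mapE.
exact: le_trans (quotient_norm_lb _ _) (map_family_norm _).
Qed.

Definition operator_ultrapower :
    bounded_operator (ultrapower U Z) (ultrapower U X) :=
  mk_bounded_operator ultrapower_map_linear ultrapower_map_continuous.

End OperatorUltrapower.

Arguments operator_ultrapower {I} U {R Z X} T.

Definition super_weakly_compact {R : realType} (X : normedModType R)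
    (K : set X) : Prop :=
  weakly_closed K /\
  forall (I : Type) (U : free_ultrafilter I), infinite_set [set: I] ->
    relatively_weakly_compact (set_ultrapower U K).

Definition super_weakly_compact_operator {R : realType} (Z X : normedModType R)
    (T : bounded_operator Z X) : Prop :=
  forall (I : Type) (U : free_ultrafilter I), infinite_set [set: I] ->
    weakly_compact_operator (operator_ultrapower U T).

(* Main.v *)
From HB Require Import structures.
Require Import Defs.
From mathcomp Require Import all_boot all_order all_algebra.
From mathcomp Require Import all_classical all_reals all_analysis.
From mathcomp Require Import ring lra.
Import Order.TTheory GRing.Theory Num.Theory.
Import numFieldNormedType.Exports.
Local Open Scope classical_set_scope.
Local Open Scope ring_scope.

Set Implicit Arguments.
Unset Strict Implicit.
Unset Printing Implicit Defensive.

(** Super weak compactness is measured by finite James patterns: points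
    [y_0, ..., y_(n-1)] of a set and functionals [f_i] in the dual ball such that
    [f_i (y_k) + e <= f_i (y_j)] for [k <= i < j].  A bounded set with no long
    [e]-pattern, for every [e], is relatively weakly compact, and patterns in an
    ultrapower of [A] descend to [A].

    If [K] is super weakly compact then its bipolar [W] has no long patterns:
    otherwise an ultraproduct of longer and longer patterns over [nat] gives
    functionals [F_i] on the ultrapower of [X]; since [K^U] is relatively weakly
    compact, some convex combinations of disjoint blocks of the [F_i] are
    uniformly close on [K^U], hence the underlying functionals are close on [K]
    and therefore on [W], which contradicts the pattern.

    The space [Z] is the Davis-Figiel-Johnson-Pelczynski interpolation space of
    [W].  Its ball is contained in [s W + d B_X] with [d] arbitrarily small, so it
    has no long patterns either, which makes the embedding super weakly compact.
    Reflexivity follows because the [l2]-sum makes functionals pulled back from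
    [X] dense in the dual of [Z]. *)

(** * The Hahn-Banach and Mazur-Orlicz theorems *)

(** Weak compactness of [K^U] does not pass formally to the ultrapower of the bipolar [W]: the
    coordinates of a family in [W] may need convex combinations of unbounded length. The argument
    therefore never compares [W^U] with [K^U]; it produces functionals that are small on [K], and
    such bounds are all that defines [W]. Patterns suit this because they are finite and
    quantitative: they survive small perturbations and descend from an ultrapower, although
    functionals on an ultrapower need not come from functionals on [X].

    Uniform closeness of convex combinations is a minimax statement. If it fails, the Mazur-Orlicz
    theorem yields a finitely additive probability under which many deviations [|F_i - F_0|] have
    mean bounded below; a Bessel estimate then selects infinitely many that are large at common
    points, against the interchange of two limits. *)

Definition sublinear {R : realType} {E : lmodType R} (p : E -> R) :=
  (forall x y, p (x + y) <= p x + p y) /\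
  (forall t x, 0 <= t -> p (t *: x) = t * p x).

Definition linear_form {R : realType} {E : lmodType R} (f : E -> R) :=
  (forall x y, f (x + y) = f x + f y) /\ (forall a x, f (a *: x) = a * f x).

Section HahnBanach.
Context {R : realType} {E : lmodType R}.
Implicit Type p : E -> R.

Lemma sublinear0 p : sublinear p -> p 0 = 0.
Proof. by move=> [_ pZ]; rewrite -(scale0r 0) pZ// mul0r. Qed.

Lemma sublinear_geN p x : sublinear p -> - p (- x) <= p x.
Proof.
move=> sp; have := sp.1 x (- x); rewrite subrr sublinear0//; lra.
Qed.

Lemma linear_form0 (f : E -> R) : linear_form f -> f 0 = 0.
Proof. by move=> [_ fZ]; rewrite -(scale0r 0) fZ mul0r. Qed.

Lemma linear_formN (f : E -> R) x : linear_form f -> f (- x) = - f x.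
Proof. by move=> [_ fZ]; rewrite -scaleN1r fZ mulN1r. Qed.

(* The infimum over a cone of perturbations is the one construction behind both
   the minimality argument and the Mazur-Orlicz theorem. *)
Lemma sublinear_inf_cone p (G : E -> R -> Prop) :
  sublinear p -> G 0 0 ->
  (forall d c d' c', G d c -> G d' c' -> G (d + d') (c + c')) ->
  (forall t d c, 0 <= t -> G d c -> G (t *: d) (t * c)) ->
  (forall d c, G d c -> c <= p d) ->
  exists q, [/\ sublinear q, forall x, q x <= p x &
                forall x d c, G d c -> q x <= p (x + d) - c].
Proof.
move=> sp G0 GD GZ Gp.
pose S x : set R := [set r | exists d c, G d c /\ r = p (x + d) - c].
have S0 x : S x !=set0 by exists (p (x + 0) - 0), 0, 0.
have Slb x : lbound (S x) (- p (- x)).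
  move=> _ [d [c [Gdc ->]]]; have := Gp _ _ Gdc.
  have := sp.1 (x + d) (- x); rewrite addrAC subrr add0r; lra.
have Sinf x : has_inf (S x) by split; [exact: S0|exists (- p (- x))].
pose q x := inf (S x).
have qG x d c : G d c -> q x <= p (x + d) - c.
  by move=> Gdc; apply: ge_inf; [exact: (Sinf x).2|exists d, c].
have qp x : q x <= p x by apply: le_trans (qG _ _ _ G0) _; rewrite addr0 subr0.
have qZ t x : 0 < t -> q (t *: x) <= t * q x.
  move=> t0; rewrite -ler_pdivrMl//; apply: lb_le_inf; first exact: S0.
  move=> _ [d [c [Gdc ->]]]; rewrite ler_pdivrMl// mulrBr -sp.2 ?(ltW t0)//.
  rewrite scalerDr. by apply: qG; apply: GZ => //; exact: ltW.
exists q; split=> //; split=> [x y|t x].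
  rewrite -lerBlDr; apply: lb_le_inf; first exact: S0.
  move=> _ [d [c [Gdc ->]]]; rewrite lerBlDr -lerBlDl; apply: lb_le_inf => //.
  move=> _ [d' [c' [Gdc' ->]]]; rewrite lerBlDl.
  apply: le_trans (qG _ _ _ (GD _ _ _ _ Gdc Gdc')) _.
  by rewrite addrACA; have := sp.1 (x + d) (y + d'); lra.
rewrite le_eqVlt => /predU1P[<-|t0].
  rewrite scale0r mul0r; apply/le_anti/andP; split.
    by apply: le_trans (qp _) _; rewrite sublinear0.
  apply: lb_le_inf => // _ [d [c [Gdc ->]]].
  by rewrite add0r subr_ge0 Gp.
apply/le_anti; rewrite qZ//=.
have := qZ t^-1 (t *: x); rewrite invr_gt0 => /(_ t0).
by rewrite scalerA mulVf ?gt_eqF// scale1r ler_pdivlMl.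
Qed.

(** For fixed [y], the infimum over [t >= 0] of [q (x + t y) - t q y] is sublinear and below [q].
    Minimality makes it equal to [q], and [t = 1] gives superadditivity. *)
Lemma minimal_sublinear_linear (q : E -> R) : sublinear q ->
  (forall q', sublinear q' -> (forall x, q' x <= q x) -> forall x, q x <= q' x) ->
  linear_form q.
Proof.
move=> sq qmin.
have qD x y : q x + q y <= q (x + y).
  pose G d c := exists2 t, 0 <= t & d = t *: y /\ c = t * q y.
  have [||||q' [sq' q'q q'G]] := @sublinear_inf_cone q G sq.
  - by exists 0; rewrite // scale0r mul0r.
  - move=> _ _ _ _ [t t0 [-> ->]] [t' t'0 [-> ->]]; exists (t + t').
      exact: addr_ge0.
    by rewrite scalerDl mulrDl.
  - move=> t _ _ t0 [t' t'0 [-> ->]]; exists (t * t'); first exact: mulr_ge0.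
    by rewrite scalerA mulrA.
  - by move=> _ _ [t t0 [-> ->]]; rewrite sq.2.
  have := qmin _ sq' q'q x; have := q'G x y (q y).
  move=> /(_ _)/[dup]; have Gy : G y (q y) by exists 1; rewrite ?scale1r ?mul1r.
  by move=> /(_ Gy) + _; lra.
have qadd x y : q (x + y) = q x + q y.
  by apply/le_anti; rewrite sq.1 qD.
split=> // a x; have [a0|a0] := leP 0 a; first exact: sq.2.
have qN z : q (- z) = - q z.
  by apply/eqP; rewrite -addr_eq0 -qadd addNr sublinear0.
by rewrite -[a in LHS]opprK scaleNr qN sq.2 ?oppr_ge0 ?(ltW a0)// mulNr opprK.
Qed.

(** Zorn's lemma is applied to the sublinear functionals below [p], ordered downwards. The pointwise
    infimum of a chain is subadditive because, of two members, the smaller one serves for both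
    arguments. *)
Theorem hahn_banach p : sublinear p ->
  exists f, linear_form f /\ forall x, f x <= p x.
Proof.
move=> sp.
pose S := {q : E -> R | sublinear q /\ forall x, q x <= p x}.
pose rS (q q' : S) := `[< forall x, sval q' x <= sval q x >].
have [||||q qmin] := @Zorn S rS.
- by move=> q; apply/asboolP => x.
- by move=> q r s /asboolP qr /asboolP rs; apply/asboolP => x; exact: le_trans (qr x).
- move=> [q Hq] [r Hr] /asboolP /= qr /asboolP /= rq.
  by apply/eq_exist/funext => x; apply/le_anti; rewrite qr rq.
- move=> A Atot; have [[q0 Aq0]|nA] := pselect (A !=set0); last first.
    have sp' : sublinear p /\ forall x, p x <= p x by [].
    by exists (exist _ p sp') => s As; exfalso; apply: nA; exists s.
  pose V x : set R := [set sval q x | q in A].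
  have Vinf x : has_inf (V x).
    split; first by exists (sval q0 x), q0.
    exists (- p (- x)) => _ [q _ <-]; case: q => q [sq qp] /=.
    by apply: le_trans (sublinear_geN x sq); rewrite lerN2.
  pose m x := inf (V x).
  have mle q x : A q -> m x <= sval q x.
    by move=> Aq; apply: ge_inf; [exact: (Vinf x).2|exists q].
  have V0 x := (Vinf x).1.
  have mZ t x : 0 < t -> m (t *: x) <= t * m x.
    move=> t0; rewrite -ler_pdivrMl//; apply: lb_le_inf => // _ [q Aq <-].
    rewrite ler_pdivrMl// -(proj1 (svalP q)).2 ?(ltW t0)//; exact: mle.
  have sm : sublinear m.
    split=> [x y|t x].
      rewrite -lerBlDr; apply: lb_le_inf => // _ [q Aq <-].
      rewrite lerBlDr -lerBlDl; apply: lb_le_inf => // _ [r Ar <-].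
      rewrite lerBlDl; have [/asboolP qr|/asboolP rq] := Atot _ _ Aq Ar.
        have := mle _ (x + y) Ar; have := (proj1 (svalP r)).1 x y.
        by have := qr x; lra.
      have := mle _ (x + y) Aq; have := (proj1 (svalP q)).1 x y.
      by have := rq y; lra.
    rewrite le_eqVlt => /predU1P[<-|t0].
      rewrite scale0r mul0r; apply/le_anti/andP; split.
        by apply: le_trans (mle _ _ Aq0) _; rewrite sublinear0//; exact: (svalP q0).1.
      apply: lb_le_inf => // _ [q Aq <-].
      by rewrite sublinear0//; exact: (svalP q).1.
    apply/le_anti; rewrite mZ//=.
    have := mZ t^-1 (t *: x); rewrite invr_gt0 => /(_ t0).
    by rewrite scalerA mulVf ?gt_eqF// scale1r ler_pdivlMl.
  have mp : sublinear m /\ forall x, m x <= p x.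
    split=> // x; apply: le_trans (mle _ x Aq0) _; exact: (svalP q0).2.
  by exists (exist _ m mp) => s As; apply/asboolP => x; exact: mle.
case: q qmin => q [sq qp] /= qmin; exists q; split=> //.
apply: minimal_sublinear_linear => // q' sq' q'q x.
have q'p : sublinear q' /\ forall x, q' x <= p x.
  by split=> // z; exact: le_trans (q'q z) (qp z).
have /(_ _)/(f_equal sval)/= := qmin (exist _ q' q'p).
by move=> ->//; apply/asboolP.
Qed.

(** [G] is a cone of constraints [c <= f d]; a linear form below the infimum [q] over it meets them,
    since [q (- d) <= p 0 - c]. A ray, the graph of a form on a subspace, or the cone over a convex
    set, taken as [G], gives norming, extension and separation. *)
Theorem mazur_orlicz p (G : E -> R -> Prop) :
  sublinear p -> G 0 0 ->
  (forall d c d' c', G d c -> G d' c' -> G (d + d') (c + c')) ->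
  (forall t d c, 0 <= t -> G d c -> G (t *: d) (t * c)) ->
  (forall d c, G d c -> c <= p d) ->
  exists f, [/\ linear_form f, forall x, f x <= p x &
                forall d c, G d c -> c <= f d].
Proof.
move=> sp G0 GD GZ Gp.
have [q [sq qp qG]] := @sublinear_inf_cone p G sp G0 GD GZ Gp.
have [f [lf fq]] := hahn_banach sq.
exists f; split=> // [x|d c Gdc]; first exact: le_trans (fq x) (qp x).
have := fq (- d); have := qG (- d) d c Gdc; rewrite addNr sublinear0//.
by rewrite -scaleN1r lf.2; lra.
Qed.

Corollary mazur_orlicz_convex p (D : set E) (c : R) :
  sublinear p -> D !=set0 ->
  (forall t x y, 0 <= t <= 1 -> D x -> D y -> D (t *: x + (1 - t) *: y)) ->
  (forall x, D x -> c <= p x) ->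
  exists f, [/\ linear_form f, forall x, f x <= p x & forall x, D x -> c <= f x].
Proof.
move=> sp [d0 Dd0] Dconv Dp.
pose G d e := exists t x, [/\ 0 <= t, D x, d = t *: x & e = t * c].
have [||||f [lf fp fG]] := @mazur_orlicz p G sp.
- by exists 0, d0; rewrite scale0r mul0r.
- move=> _ _ _ _ [t [x [t0 Dx -> ->]]] [s [y [s0 Dy -> ->]]].
  have [ts0|ts] := eqVneq (t + s) 0.
    have -> : t = 0 by lra.
    have -> : s = 0 by lra.
    by exists 0, x; rewrite !scale0r !mul0r !addr0.
  have ts1 : 0 <= t / (t + s) <= 1.
    rewrite divr_ge0//= ?addr_ge0// ler_pdivrMr; first by lra.
    by rewrite lt_neqAle eq_sym ts addr_ge0.
  exists (t + s), (t / (t + s) *: x + (1 - t / (t + s)) *: y); split.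
  + exact: addr_ge0.
  + exact: Dconv.
  + rewrite scalerDr !scalerA; congr (_ *: _ + _ *: _); field => //.
  + by rewrite mulrDl.
- move=> t _ _ t0 [s [x [s0 Dx -> ->]]]; exists (t * s), x.
  by rewrite scalerA mulrA mulr_ge0.
- by move=> _ _ [t [x [t0 Dx -> ->]]]; rewrite sp.2// ler_wpM2l// Dp.
exists f; split=> // x Dx; apply: fG; exists 1, x.
by rewrite scale1r mul1r.
Qed.

End HahnBanach.

(** * Ultralimits and the weak topology *)

Lemma fmap_ultra (T U : Type) (f : T -> U) (V : set_system T) :
  UltraFilter V -> UltraFilter (fmap f V).
Proof.
move=> VU; split; first exact: fmap_proper_filter.
move=> G GF VG; apply/seteqP; split=> // A GA.
have [//|VnA] := in_ultra_setVsetC (f @^-1` A) VU.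
have GnA : G (~` A) by apply: VG.
by have := filter_ex (filterI GA GnA) => -[x []].
Qed.

Definition ulim {R : realType} {T : Type} (V : set_system T) (f : T -> R) : R :=
  lim (f @ V).

Section UltraLimit.
Context {R : realType} {T : Type} {V : set_system T} {VU : UltraFilter V}.
Implicit Types (f g : T -> R) (M l : R).

Lemma ulim_cvg_near f M : (\forall t \near V, `|f t| <= M) -> f @ V --> ulim V f.
Proof.
move=> fM; have VfU : UltraFilter (f @ V) by exact: fmap_ultra.
have := @segment_compact R (- M) M; rewrite compact_ultra.
move=> /(_ _ VfU)[].
  by apply: filterS fM => t; rewrite /= in_itv/= -ler_norml.
by move=> l [_ fl]; apply/cvg_ex; exists l.
Qed.

Lemma ulim_cvg f M : (forall t, `|f t| <= M) -> f @ V --> ulim V f.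
Proof. by move=> fM; apply: (@ulim_cvg_near _ M); exact: nearW. Qed.

Lemma cvg_ulim f l : f @ V --> l -> ulim V f = l.
Proof. by move=> fl; apply: cvg_lim. Qed.

Lemma ultra_cvg_le f l M : f @ V --> l -> (\forall t \near V, f t <= M) -> l <= M.
Proof.
move=> fl fM; rewrite -(cvg_ulim fl); apply: limr_le => //.
by apply/cvg_ex; exists l.
Qed.

Lemma ultra_cvg_ge f l M : f @ V --> l -> (\forall t \near V, M <= f t) -> M <= l.
Proof.
move=> fl fM; rewrite -(cvg_ulim fl); apply: limr_ge => //.
by apply/cvg_ex; exists l.
Qed.

Lemma ultra_cvg_near f l e : f @ V --> l -> 0 < e ->
  \forall t \near V, `|f t - l| < e.
Proof. by move=> /cvgrPdistC_lt; exact. Qed.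

Lemma ultra_cvg_seq (n : nat) (c : T -> nat -> R) (M : R) :
  (forall t j, `|c t j| <= M) -> exists l : nat -> R,
  forall e, 0 < e -> \forall t \near V, forall j, (j < n)%N -> `|c t j - l j| < e.
Proof.
move=> cM; exists (fun j => ulim V (fun t => c t j)) => e e0.
elim: n => [|n IHn]; first exact: nearW.
have cn := ultra_cvg_near (ulim_cvg (fun t => cM t n)) e0.
apply: filterS2 IHn cn => t IH cn j; rewrite ltnS leq_eqVlt => /predU1P[->//|].
exact: IH.
Qed.

End UltraLimit.

Lemma nat_free_ultrafilter : exists U : free_ultrafilter nat,
  forall n, \forall i \near ultra_sets U, (n <= i)%N.
Proof.
have [G [GU oG]] := @ultraFilterLemma nat \oo eventually_filter.
have Gn n : G [set i | (n <= i)%N] by apply: oG; exists n.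
have G0 : \bigcap_(A in G) A = set0.
  by rewrite -subset0 => n /(_ _ (Gn n.+1)); rewrite /= ltnn.
by exists (FreeUltrafilter GU G0).
Qed.

Section Dual.
Context {R : realType} {X : normedModType R}.
Implicit Types (f g : dual X) (x y : X).

Lemma dualD f x y : f (x + y) = f x + f y.
Proof. exact: linearD. Qed.

Lemma dualZ f a x : f (a *: x) = a * f x.
Proof. exact: linearZ. Qed.

Lemma dualN f x : f (- x) = - f x.
Proof. exact: linearN. Qed.

Lemma dual_le f x : `|f x| <= `|f| * `|x|.
Proof. exact: operator_normP. Qed.

Lemma dual_le1 f x M : `|f| <= 1 -> `|x| <= M -> `|f x| <= M.
Proof.
move=> f1 xM; apply: le_trans (dual_le f x) (le_trans _ xM).
by rewrite ler_piMl.
Qed.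

Lemma dual_norm_le f M : 0 <= M -> (forall x, `|f x| <= M * `|x|) -> `|f| <= M.
Proof.
move=> M0 fM; apply: operator_norm_lub => x x1; apply: le_trans (fM x) _.
by rewrite ler_piMr.
Qed.

Lemma linear_form_dual (h : X -> R) M : linear_form h -> 0 <= M ->
  (forall x, h x <= M * `|x|) ->
  exists f : dual X, (forall x, f x = h x) /\ `|f| <= M.
Proof.
move=> [hD hZ] M0 hM.
have hM' x : `|h x| <= M * `|x|.
  rewrite ler_norml hM andbT lerNl -mulN1r -hZ scaleN1r.
  by apply: le_trans (hM _) _; rewrite normrN.
have hl : linear (h : X -> GRing.regular R) by move=> a x y; rewrite hD hZ.
have hc : continuous (h : X -> GRing.regular R) by exact: (bound_continuous hl hM').
by exists (mk_bounded_operator hl hc); split=> //; exact: dual_norm_le.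
Qed.

Lemma sublinear_norm M : 0 <= M -> sublinear (fun x : X => M * `|x|).
Proof.
move=> M0; split=> [x y|t x t0]; first by rewrite -mulrDr ler_wpM2l// ler_normD.
by rewrite normrZ ger0_norm// mulrCA.
Qed.

Lemma linear_form_sum (E : lmodType R) (h : E -> R) (n : nat) (c : nat -> R) (y : nat -> E) :
  linear_form h -> h (\sum_(j < n) c j *: y j) = \sum_(j < n) c j * h (y j).
Proof.
move=> lh; elim: n => [|n IHn].
  by rewrite !big_ord0 -(scale0r 0) lh.2 mul0r.
by rewrite !big_ord_recr/= lh.1 lh.2 IHn.
Qed.

Lemma dual_linear_form f : linear_form f.
Proof. by split=> [x y|a x]; [exact: dualD|exact: dualZ]. Qed.

End Dual.

Section WeakTopology.
Context {R : realType} {X : normedModType R}.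
Implicit Types (A : set X).

Lemma weak_cvgP (F : set_system X) (FF : Filter F) (x : X) :
  (F : set_system (weak X)) --> (x : weak X) <-> forall f : dual X, f @ F --> f x.
Proof.
split=> [Fx f|Fx].
  have Fxf := (cvg_sup (fun f : dual X => Topological.class (initial_topology (f : X -> R))) x FF).1 Fx f.
  apply: cvg_trans (@initial_continuous _ _ (f : X -> R) x); exact: cvg_app.
apply/cvg_sup => f A /= [_ [[B Bop <-] Bfs sBfA]].
apply: filterS sBfA _; apply: Fx; exact: open_nbhs_nbhs.
Qed.

Lemma weak_continuous (f : dual X) : continuous (f : weak X -> R).
Proof.
move=> x; have [+ _] := @weak_cvgP (nbhs (x : weak X)) _ x.
by move=> /(_ cvg_id)/(_ f).
Qed.

Lemma weak_closure_approx A y (s : seq (dual X)) (e : R) :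
  closure (A : set (weak X)) y -> 0 < e ->
  exists2 a, A a & forall f, f \in s -> `|f a - f y| < e.
Proof.
move=> Ay e0; have : nbhs (y : weak X) [set a : X | forall f, f \in s -> `|f a - f y| < e].
  elim: s => [|f s IH]; first exact: filterS filterT.
  have fy : nbhs (y : weak X) [set a : X | `|f a - f y| < e].
    by have /cvgrPdistC_lt/(_ _ e0) := @weak_continuous f y.
  apply: filterS2 fy IH => a fa IH g; rewrite inE => /predU1P[->//|]; exact: IH.
by move=> /Ay[a [Aa fa]]; exists a.
Qed.

Lemma rel_weakly_compact_limit_near A (T : Type) (V : set_system T) (x : T -> X) :
  relatively_weakly_compact A -> UltraFilter V -> (\forall t \near V, A (x t)) ->
  exists y, forall f : dual X, (fun t => f (x t)) @ V --> f y.
Proof.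
rewrite /relatively_weakly_compact precompactE compact_ultra => Ac VU Ax.
have [|y [_ /weak_cvgP xy]] := Ac _ (fmap_ultra (x : T -> weak X) VU).
  by apply: filterS Ax => t; exact: subset_closure.
by exists y => f; exact: xy.
Qed.

Lemma rel_weakly_compact_limit A (T : Type) (V : set_system T) (x : T -> X) :
  relatively_weakly_compact A -> UltraFilter V -> (forall t, A (x t)) ->
  exists y, forall f : dual X, (fun t => f (x t)) @ V --> f y.
Proof.
move=> Ac VU Ax; apply: (rel_weakly_compact_limit_near Ac VU _); by apply: nearW => t; exact: Ax.
Qed.

Lemma rel_weakly_compact_subset A B :
  A `<=` B -> relatively_weakly_compact B -> relatively_weakly_compact A.
Proof. exact: (@precompact_subset (weak X)). Qed.

Lemma rel_weakly_compact_intro A :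
  (forall G : set_system X, UltraFilter G -> G (closure (A : set (weak X))) ->
    exists y, forall f : dual X, f @ G --> f y) ->
  relatively_weakly_compact A.
Proof.
move=> AG; rewrite /relatively_weakly_compact precompactE compact_ultra => G GU GA.
have [y Gy] := AG G GU GA.
have Gyw : (G : set_system (weak X)) --> (y : weak X) by apply/weak_cvgP.
exists y; split=> //; rewrite closureE => B [cB AB].
have : closure B y.
  move=> C /Gyw GC; have GB : G B by apply: filterS GA; rewrite closureE => z; apply.
  by have [z] := filter_ex (filterI GB GC); exists z.
by rewrite -(closure_id B).1.
Qed.

End WeakTopology.

(** * James patterns and weak compactness *)

Lemma norming_functional (R : realType) (X : normedModType R) (x : X) :
  exists f : dual X, `|f| <= 1 /\ f x = `|x|.
Proof.
pose G d c := exists2 t, 0 <= t & d = t *: x /\ c = t * `|x|.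
have s1 := @sublinear_norm R X 1 ler01.
have [||||h [lh hle hG]] := @mazur_orlicz R X _ G s1.
- by exists 0; rewrite // scale0r mul0r.
- move=> _ _ _ _ [t t0 [-> ->]] [s s0 [-> ->]]; exists (t + s).
    exact: addr_ge0.
  by rewrite scalerDl mulrDl.
- move=> t _ _ t0 [s s0 [-> ->]]; exists (t * s); first exact: mulr_ge0.
  by rewrite scalerA mulrA.
- by move=> _ _ [t t0 [-> ->]]; rewrite mul1r normrZ ger0_norm.
have [f [fh f1]] := linear_form_dual lh ler01 hle.
exists f; split=> //; apply/le_anti/andP; split.
  by rewrite fh -[leRHS]mul1r; exact: hle.
by rewrite fh; apply: hG; exists 1; rewrite ?scale1r ?mul1r.
Qed.

Lemma norm_le_dual (R : realType) (X : normedModType R) (x : X) (M : R) :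
  (forall f : dual X, `|f| <= 1 -> f x <= M) -> `|x| <= M.
Proof. by move=> xM; have [f [f1 <-]] := norming_functional x; exact: xM. Qed.

(* [f i] puts the points of index at most [i] below those of index above [i],
   with a gap [e]: arbitrarily long patterns are James's obstruction to weak
   compactness, read at finite level. *)
Definition pattern {R : realType} {X : normedModType R} (A : set X) (n : nat) (e : R) :=
  exists (y : nat -> X) (f : nat -> dual X),
    [/\ forall j, A (y j), forall i, `|f i| <= 1 &
        forall i j k, (k <= i)%N -> (i < j)%N -> (j < n)%N -> f i (y k) + e <= f i (y j)].

(** Completeness as a predicate on a normed space, so that it can be proved afterwards of
    ultrapowers, duals and interpolation spaces. Sequences with geometric gaps suffice, and their
    explicit rate stands for convergence. *)
Definition rapid_complete {R : realType} (X : normedModType R) :=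
  forall u : nat -> X, (forall n, `|u n.+1 - u n| <= 2^-1 ^+ n) ->
    exists y, forall n, `|y - u n| <= 2 * 2^-1 ^+ n.

Lemma half_expn_small (R : realType) (e : R) : 0 < e -> exists n, 2^-1 ^+ n < e.
Proof.
move=> e0; have h1 : `|2^-1 : R| < 1 by rewrite gtr0_norm ?invr_gt0// invf_lt1// ltr1n.
have /cvgrPdist_lt/(_ e e0)[n _ /(_ n (leqnn n))] := cvg_geometric 1 h1.
rewrite /geometric/= mul1r sub0r normrN gtr0_norm ?exprn_gt0 ?invr_gt0// => ne.
by exists n.
Qed.

Section NoPattern.
Context {R : realType} {X : normedModType R}.
Implicit Types (A : set X) (Phi : dual X -> R).

Lemma vanishing_on_kernel Phi (s : seq X) : linear_form Phi ->
  (forall f : dual X, (forall a, a \in s -> f a = 0) -> Phi f = 0) ->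
  exists y, forall f : dual X, Phi f = f y.
Proof.
elim: s Phi => [|a s IH] Phi lP Ps.
  by exists 0 => f; rewrite linear0; apply: Ps.
have [fa|] := pselect (forall f : dual X, (forall b, b \in s -> f b = 0) -> f a = 0).
  apply: IH => // f fs; apply: Ps => b; rewrite inE => /predU1P[->|]; last exact: fs.
  exact: fa.
move=> /existsNP[f0 /not_implyP[f0s /eqP f0a]].
pose c := Phi f0 / f0 a.
have [||y yP] := IH (fun f : dual X => Phi f - c * f a).
- split=> [f g|t f]; first by rewrite lP.1 -[(f + g) a]/(f a + g a); ring.
  by rewrite lP.2 -[(t *: f) a]/(t * f a); ring.
- move=> f fs; have : Phi (f - (f a / f0 a) *: f0) = 0.
    apply: Ps => b.
    rewrite -[(f - _) b]/(f b - f a / f0 a * f0 b) inE => /predU1P[->|bs].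
      by rewrite divfK// subrr.
    by rewrite (fs b bs) (f0s b bs) mulr0 subrr.
  rewrite -scaleNr lP.1 lP.2 /c => <-; field; exact: f0a.
exists (y + c *: a) => f; rewrite dualD dualZ -yP; ring.
Qed.

(** Otherwise [Phi] is at most [r |f|] on the annihilator of [s]. An extension [h] with this bound
    on the whole dual differs from [Phi] by a form vanishing on the annihilator, hence by the
    evaluation at some [y]; that [y] contradicts the distance hypothesis. *)
Lemma helly Phi (r : R) (s : seq X) : linear_form Phi -> 0 <= r ->
  (forall y, exists f : dual X, r * `|f| < Phi f - f y) ->
  exists f : dual X, [/\ `|f| <= 1, forall a, a \in s -> f a = 0 & r < Phi f].
Proof.
move=> lP r0 Pfar; apply: contrapT => nf.
have Ple (f : dual X) : (forall a, a \in s -> f a = 0) -> Phi f <= r * `|f|.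
  move=> fs; have [->|f0] := eqVneq f 0.
    by rewrite normr0 mulr0 linear_form0.
  rewrite -ler_pdivrMr ?normr_gt0// leNgt; apply/negP => rP; apply: nf.
  exists (`|f|^-1 *: f); split.
  - by rewrite normrZ normfV normr_id mulVf// normr_eq0.
  - by move=> a /fs fa; rewrite -[(_ *: f) a]/(_ * f a) fa mulr0.
  - by rewrite lP.2 mulrC.
pose G (f : dual X) c := (forall a, a \in s -> f a = 0) /\ c = Phi f.
have [||||h [lh hle hG]] := @mazur_orlicz R (dual X) _ G (@sublinear_norm R (dual X) r r0).
- by split=> //; rewrite linear_form0.
- move=> f c g d [fs ->] [gs ->]; split; last by rewrite lP.1.
  by move=> a a_s; rewrite -[(f + g) a]/(f a + g a) fs// gs// addr0.
- move=> t f c t0 [fs ->]; split; last by rewrite lP.2.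
  by move=> a a_s; rewrite -[(t *: f) a]/(t * f a) fs// mulr0.
- by move=> f c [fs ->]; exact: Ple.
have [||y yP] := @vanishing_on_kernel (fun f : dual X => Phi f - h f) s.
- by split=> [f g|t f]; rewrite ?lP.1 ?lh.1 ?lP.2 ?lh.2; ring.
- move=> f fs; apply/le_anti; rewrite !(subr_ge0, subr_le0) hG//= -lerN2.
  rewrite -!linear_formN// hG//; split=> // a a_s.
  by rewrite -[(- f) a]/(- f a) fs// oppr0.
have [f] := Pfar y; rewrite -yP; have := hle f; lra.
Qed.

(** A complete [X] is closed in its bidual: if [Phi] has no positive distance from the evaluations,
    points within [2^-n / 2] of it form a rapid sequence, whose limit represents [Phi]. *)
Lemma evaluation_or_far Phi : rapid_complete X -> linear_form Phi ->
  (exists y, forall f : dual X, Phi f = f y) \/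
  (exists2 r, 0 < r & forall y, exists f : dual X, r * `|f| < Phi f - f y).
Proof.
move=> cX lP; have [|nfar] := pselect (exists2 r, 0 < r &
  forall y, exists f : dual X, r * `|f| < Phi f - f y); first by right.
left; have half n : 0 < 2^-1 ^+ n :> R by rewrite exprn_gt0// invr_gt0.
have /choice[u uP] : forall n, exists y, forall f : dual X,
    `|Phi f - f y| <= 2^-1 ^+ n / 2 * `|f|.
  move=> n; apply: contrapT => ny; apply: nfar.
  exists (2^-1 ^+ n / 2); first by rewrite divr_gt0.
  move=> y; apply: contrapT => nf; apply: ny; exists y.
  have le1 g : Phi g - g y <= 2^-1 ^+ n / 2 * `|g|.
    by rewrite leNgt; apply/negP => h; apply: nf; exists g.
  move=> f; rewrite ler_norml le1 andbT lerNl.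
  have := le1 (- f); rewrite normrN -[(- f) y]/(- f y) (linear_formN f lP).
  lra.
have [|y yP] := cX u.
  move=> n; apply: norm_le_dual => f f1; rewrite dualD dualN.
  have := uP n.+1 f; have := uP n f; rewrite exprS.
  rewrite !ler_norml => /andP[_ h1] /andP[h2 _].
  have h3 : 2^-1 ^+ n * `|f| <= 2^-1 ^+ n by rewrite ler_piMr// ltW.
  have : 0 <= 2^-1 ^+ n * `|f| by rewrite mulr_ge0// ltW.
  move: h1 h2 h3; set q := _ ^+ n; set v := `|f| => h1 h2 h3 h4.
  have : q / 2 * v = q * v / 2 by field.
  have : 2^-1 * q / 2 * v = q * v / 4 by field.
  lra.
exists y => f; apply/eqP; rewrite -subr_eq0 -normr_le0; apply/ler_addgt0Pl => e e0.
have c0 : 0 < 3 * (`|f| + 1) by rewrite mulr_gt0// ltr_wpDl.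
have [n] := half_expn_small (divr_gt0 e0 c0).
rewrite ltr_pdivlMr// addr0 => ne.
have -> : Phi f - f y = (Phi f - f (u n)) - f (y - u n) by rewrite dualD dualN; ring.
apply: le_trans (ler_normB _ _) _.
have h1 := uP n f; have h2 := le_trans (dual_le f _) (ler_wpM2l (normr_ge0 f) (yP n)).
apply: le_trans (lerD h1 h2) (le_trans _ (ltW ne)).
have := half n; set q := _ ^+ n; set v := `|f| => q0.
have v0 : 0 <= v by exact: normr_ge0.
have := mulr_ge0 (ltW q0) v0; nra.
Qed.

(** James's construction. Limits along the ultrafilter define [Phi] in the bidual. If it is not an
    evaluation, functionals and points are chosen alternately: [f_n] vanishes at the earlier points
    while [Phi f_n > r], and [y_n] in [A] imitates [Phi] within [r / 2] on [f_0, ..., f_n]. *)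
Lemma no_pattern_rel_weakly_compact A (M : R) : rapid_complete X ->
  (forall a, A a -> `|a| <= M) ->
  (forall e, 0 < e -> exists n, ~ pattern A n e) ->
  relatively_weakly_compact A.
Proof.
move=> cX AM nopat; apply: rel_weakly_compact_intro => G GU GA.
have GM (f : dual X) : \forall y \near G, `|f y| <= `|f| * M.
  apply: filterS GA => y Ay; apply/ler_addgt0Pl => e e0.
  have [a Aa /(_ f)] := weak_closure_approx [:: f] Ay e0.
  rewrite mem_head => /(_ isT); rewrite distrC => fe.
  rewrite -[f y](subrK (f a)); apply: le_trans (ler_normD _ _) _.
  apply: lerD; first exact: ltW.
  by apply: le_trans (dual_le _ _) _; rewrite ler_wpM2l// AM.
pose Phi (f : dual X) := ulim G f.
have Pcvg (f : dual X) : f @ G --> Phi f by exact: ulim_cvg_near (GM f).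
have lP : linear_form Phi.
  split=> [f g|a f]; apply: cvg_ulim.
    by apply: cvgD; exact: Pcvg.
  by apply: cvgM; [exact: cvg_cst|exact: Pcvg].
have approx (s : seq (dual X)) e : 0 < e ->
    exists2 a, A a & forall f, f \in s -> `|f a - Phi f| < e.
  move=> e0; have e2 : 0 < e / 2 by rewrite divr_gt0.
  have : \forall y \near G, forall f, f \in s -> `|f y - Phi f| < e / 2.
    elim: s => [|f s IH]; first exact: nearW.
    apply: filterS2 (ultra_cvg_near (Pcvg f) e2) IH => y fy IH g.
    by rewrite inE => /predU1P[->//|]; exact: IH.
  move=> /(filterI GA)/filter_ex[y [Ay ys]].
  have [a Aa as_] := weak_closure_approx s Ay e2.
  exists a => // f fs; rewrite -[f a](subrK (f y)) -addrA [e]splitr.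
  by apply: le_lt_trans (ler_normD _ _) (ltrD (as_ _ fs) (ys _ fs)).
have [[y yP]|[r r0 far]] := evaluation_or_far cX lP.
  by exists y => f; rewrite -yP.
exfalso; have r2 : 0 < r / 2 by rewrite divr_gt0.
have [n []] := nopat _ r2.
have [a0 Aa0 _] := approx [::] 1 ltr01.
suff [y [f [Ay f1 fP f0 fy]]] : exists (y : nat -> X) (f : nat -> dual X),
    [/\ forall j, A (y j), forall i, `|f i| <= 1,
        forall i, (i < n)%N -> r < Phi (f i),
        forall i k, (k < i)%N -> (i < n)%N -> f i (y k) = 0 &
        forall i j, (i <= j)%N -> (j < n)%N -> `|f i (y j) - Phi (f i)| < r / 2].
  (* [f i] vanishes only at points of index below [i], whereas a pattern concerns indices up to [i];
     hence the shift. *)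
  exists y, (fun i => f i.+1); split=> // i j k ki ij jn.
  have ijn : (i.+1 < n)%N by exact: leq_ltn_trans jn.
  rewrite f0// add0r; have := fP i.+1 ijn.
  have := fy i.+1 j ij jn; rewrite ltr_norml => /andP[+ _]; lra.
elim: n => [|n [y [f [Ay f1 fP f0 fy]]]].
  by exists (fun=> a0), (fun=> 0); split=> // i; rewrite normr0.
have [g [g1 gy gP]] := helly [seq y k | k <- iota 0 n] lP (ltW r0) far.
have [b Ab bP] := approx (g :: [seq f k | k <- iota 0 n]) _ r2.
have mem_iota0 k : (k < n)%N -> k \in iota 0 n by rewrite mem_iota add0n.
exists (fun j => if (j < n)%N then y j else b), (fun i => if (i < n)%N then f i else g).
split.
- by move=> j; case: ifP.
- by move=> i; case: ifP.
- by move=> i _; case: ifP => // /fP.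
- move=> i k ki; rewrite ltnS => ni; rewrite (leq_trans ki ni).
  case: ifP => [ii|_]; first exact: f0.
  by apply: gy; apply: map_f; apply: mem_iota0; exact: leq_trans ki ni.
- move=> i j ij; rewrite ltnS => jn; case: (ltnP j n) => [jn'|_].
    by rewrite (leq_ltn_trans ij jn'); exact: fy.
  case: ifP => [ii|_]; last by apply: bP; rewrite mem_head.
  by apply: bP; rewrite inE map_f ?orbT ?mem_iota0.
Qed.

End NoPattern.

(** * Ultrapowers *)

Section RapidSequence.
Context {R : realType} {X : normedModType R} (u : nat -> X).
Hypothesis uh : forall n, `|u n.+1 - u n| <= 2^-1 ^+ n.

Lemma rapid_tail n m : (n <= m)%N -> `|u m - u n| <= 2 * 2^-1 ^+ n.
Proof.
have tail k : `|u (n + k)%N - u n| <= 2 * 2^-1 ^+ n - 2 * 2^-1 ^+ (n + k).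
  elim: k => [|k IHk]; first by rewrite addn0 !subrr normr0.
  rewrite -[u (n + k.+1)%N](subrK (u (n + k)%N)) -addrA.
  apply: le_trans (ler_normD _ _) _; apply: le_trans (lerD _ IHk) _.
    by rewrite addnS; exact: uh.
  by rewrite addnS exprS; lra.
move=> /subnKC <-; apply: le_trans (tail _) _.
by rewrite gerBl mulr_ge0// exprn_ge0// invr_ge0.
Qed.

Lemma rapid_limit (y : X) n :
  (forall e, 0 < e -> exists N, forall m, (N <= m)%N -> `|y - u m| < e) ->
  `|y - u n| <= 2 * 2^-1 ^+ n.
Proof.
move=> uy; apply/ler_addgt0Pl => e e0; have [N yN] := uy e e0.
rewrite -[y](subrK (u (maxn n N))) -addrA; apply: le_trans (ler_normD _ _) _.
by apply: lerD; [apply/ltW/yN/leq_maxr|apply/rapid_tail/leq_maxl].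
Qed.

End RapidSequence.

Lemma rapid_complete_banach (R : realType) (X : completeNormedModType R) :
  rapid_complete X.
Proof.
move=> u uh; have : cvg (u @ \oo).
  apply/cauchy_cvgP/cauchy_exP => e e0.
  have [n ne] := half_expn_small (divr_gt0 e0 (ltr0n R 3)).
  exists (u n); exists n => // m /= nm; rewrite -ball_normE /ball_/= distrC.
  have half : 0 < 2^-1 ^+ n :> R by rewrite exprn_gt0// invr_gt0.
  apply: le_lt_trans (rapid_tail uh nm) _; lra.
move=> /cvg_ex[y /cvgrPdist_lt uy]; exists y => n; apply: rapid_limit => // e e0.
by have [N _ yN] := uy e e0; exists N => m Nm; exact: yN.
Qed.

Definition mk_bounded_family {I : Type} {R : realType} {X : normedModType R}
    (x : I -> X) (M : R) (xM : forall i, `|x i| <= M) : bounded_family I X :=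
  BoundedFamily (introT (asboolP _) ((bounded_familyP x).2 (ex_intro _ M xM))).

Section Ultrapower.
Context {I : Type} (U : free_ultrafilter I) {R : realType} {X : normedModType R}.
Implicit Types (x : bounded_family I X).
Local Notation XU := (ultrapower U X).

Lemma ultra_norm_lb x : `|ultraclass U x : XU| <= `|x|.
Proof. exact: quotient_norm_lb. Qed.

(** The quotient norm is an infimum over representatives, and the family may be replaced by 0
    outside the large set where the bound holds. *)
Lemma ultra_norm_le x (r : R) : 0 <= r ->
  (\forall i \near ultra_sets U, `|x i| <= r) -> `|ultraclass U x : XU| <= r.
Proof.
move=> r0 xr; have trr i : `|if `|x i| <= r then x i else 0| <= r.
  by case: ifP => // _; rewrite normr0.
have -> : ultraclass U x = ultraclass U (mk_bounded_family trr).
  apply/ultraclass_eq/null_familyP => e e0; apply: filterS xr => i xir.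
  by rewrite -[(x - _) i]/(x i - if `|x i| <= r then x i else 0) xir subrr normr0.
by apply: le_trans (ultra_norm_lb _) _; exact: sup_norm_lub.
Qed.

Lemma rapid_complete_ultrapower : rapid_complete X -> rapid_complete XU.
Proof.
move=> cX c ch; have half n : 0 < 2^-1 ^+ n :> R by rewrite exprn_gt0// invr_gt0.
(* The slack in lifting a difference doubles its bound. Starting from [c 1] absorbs this factor, and
   the lifted partial sums are rapid in every coordinate. *)
have /choice[d dP] : forall n, exists d : bounded_family I X,
    ultraclass U d = c n.+2 - c n.+1 /\ `|d| <= 2^-1 ^+ n.
  move=> n; have [d dc dn] := quotient_norm_adherent (c n.+2 - c n.+1) (half n.+1).
  exists d; split=> //; apply/ltW/(lt_le_trans dn).
  apply: le_trans (lerD (ch n.+1) (lexx _)) _.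
  by rewrite exprS; have := half n; lra.
pose x n := ultrarepr (c 1%N) + \sum_(k < n) d k.
have xc n : ultraclass U (x n) = c n.+1.
  elim: n => [|n IHn]; first by rewrite /x big_ord0 addr0 ultrareprK.
  rewrite /x big_ord_recr/= addrA ultraclassD -/(x n) IHn (dP n).1.
  by rewrite addrC subrK.
have /choice[y yP] i : exists y, forall n, `|y - x n i| <= 2 * 2^-1 ^+ n.
  apply: cX => n; apply: le_trans (dP n).2; apply: le_trans (sup_norm_ub _ i).
  have -> : x n.+1 = x n + d n by rewrite /x big_ord_recr/= addrA.
  by rewrite -[(x n + d n) i]/(x n i + d n i) addrAC subrr add0r.
have yM i : `|y i| <= `|x 0%N| + 2.
  rewrite -[y i](subrK (x 0%N i)) addrC; apply: le_trans (ler_normD _ _) _.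
  by apply: lerD; [exact: sup_norm_ub|have := yP i 0%N; rewrite expr0 mulr1].
pose z := mk_bounded_family yM.
have zc n : `|ultraclass U z - c n.+1| <= 2 * 2^-1 ^+ n.
  rewrite -xc -linearB/=; apply: ultra_norm_le; first by rewrite mulr_ge0// ltW.
  by apply: nearW => i; exact: yP.
exists (ultraclass U z) => n; apply: rapid_limit => // e e0.
have [N Ne] := half_expn_small (divr_gt0 e0 (ltr0n R 2)).
exists N.+1 => -[//|m]; rewrite ltnS => Nm; apply: le_lt_trans (zc m) _.
rewrite -ltr_pdivlMl// mulrC; apply: le_lt_trans Ne.
by rewrite ler_wiXn2l// ?invr_ge0// invf_le1// ler1n.
Qed.

Lemma ultra_functional (F : I -> dual X) : (forall i, `|F i| <= 1) ->
  exists g : dual XU, `|g| <= 1 /\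
    forall x, (fun i => F i (x i)) @ ultra_sets U --> g (ultraclass U x).
Proof.
move=> F1; pose h (c : XU) := ulim (ultra_sets U) (fun i => F i (ultrarepr c i)).
have Fb x i : `|F i (x i)| <= `|x| by apply: dual_le1 => //; exact: sup_norm_ub.
have hc x : (fun i => F i (x i)) @ ultra_sets U --> h (ultraclass U x).
  have : (fun i => F i ((x - ultrarepr (ultraclass U x)) i)) @ ultra_sets U --> (0 : R).
    apply/cvgrPdistC_lt => e e0.
    have /ultraclass_eq/null_familyP/(_ e e0) :
      ultraclass U x = ultraclass U (ultrarepr (ultraclass U x)) by rewrite ultrareprK.
    apply: filterS => i; rewrite subr0; apply: le_lt_trans.
    exact: dual_le1.
  move=> /(cvgD (ulim_cvg (Fb (ultrarepr (ultraclass U x))))); rewrite addr0.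
  apply: cvg_trans; apply: near_eq_cvg; apply: nearW => i /=.
  rewrite fctE -dualD; congr (F i _); set c := ultrarepr _.
  exact: (etrans (addrC (c i) (x i - c i)) (subrK _ _)).
have lh : linear_form h.
  split=> [c d|a c].
    rewrite -[c]ultrareprK -[d]ultrareprK -ultraclassD; apply: cvg_unique (hc _) _ => //.
    apply: cvg_trans (cvgD (hc (ultrarepr c)) (hc (ultrarepr d))).
    by apply: near_eq_cvg; apply: nearW => i /=; rewrite fctE -dualD.
  rewrite -[c]ultrareprK -linearZ/=; apply: cvg_unique (hc _) _ => //.
  apply: cvg_trans (cvgM (cvg_cst a) (hc (ultrarepr c))).
  by apply: near_eq_cvg; apply: nearW => i /=; rewrite fctE -dualZ.
have h1 c : h c <= 1 * `|c|.
  rewrite mul1r; apply/ler_addgt0Pl => e e0.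
  have [x <- xe] := quotient_norm_adherent c e0.
  apply: ultra_cvg_le (hc x) _; apply: nearW => i.
  apply: le_trans (ler_norm _) (le_trans (Fb x i) _).
  by rewrite addrC ltW.
have [g [gh g1]] := linear_form_dual lh ler01 h1.
by exists g; split=> // x; rewrite gh; exact: hc.
Qed.

Lemma bounded_family_sum (n : nat) (c : nat -> R) (x : nat -> bounded_family I X) i :
  (\sum_(j < n) c j *: x j) i = \sum_(j < n) c j *: x j i.
Proof.
elim: n => [|n IHn]; first by rewrite !big_ord0.
by rewrite !big_ord_recr/= -IHn.
Qed.

End Ultrapower.

(** * Descent of patterns from an ultrapower *)

Lemma sum_delta (R : realType) (E : lmodType R) (n j : nat) (y : nat -> E) :
  (j < n)%N -> \sum_(l < n) (l == j :> nat)%:R *: y l = y j.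
Proof.
move=> jn; rewrite (bigD1 (Ordinal jn))//= eqxx scale1r big1 ?addr0// => l.
by rewrite -val_eqE/= => /negPf ->; rewrite scale0r.
Qed.

Lemma ultra_near_forall_lt {T : Type} {V : set_system T} {FV : Filter V} (n : nat)
    (P : nat -> set T) :
  (forall i, (i < n)%N -> V (P i)) -> \forall t \near V, forall i, (i < n)%N -> P i t.
Proof.
elim: n => [_|n IHn VP]; first exact: nearW.
have /IHn IH i : (i < n)%N -> V (P i) by move=> /ltnW; exact: VP.
apply: filterS2 (VP n (ltnSn n)) IH => t Pn IH i; rewrite ltnS leq_eqVlt.
by move=> /predU1P[->//|]; exact: IH.
Qed.

(* Coefficient vectors of the differences between a convex combination of the
   entries in [i.+1, n[ and one of the entries in [0, i], described by duality. *)
Definition gap_coefficients {R : realType} (n i : nat) (c : nat -> R) :=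
  (forall j, `|c j| <= 1) /\
  forall (h : nat -> R) (e : R),
    (forall j k, (k <= i)%N -> (i < j)%N -> (j < n)%N -> h k + e <= h j) ->
    e <= \sum_(j < n) c j * h j.

Section GapCoefficients.
Context {R : realType} (n i : nat).

Lemma gap_coefficients_delta j k : (k <= i)%N -> (i < j)%N -> (j < n)%N ->
  gap_coefficients n i (fun l => (l == j)%:R - (l == k)%:R : R).
Proof.
move=> ki ij jn; split=> [l|h e he].
  case: (l == j); case: (l == k); rewrite ?subrr ?subr0 ?sub0r ?normrN ?normr0 ?normr1//.
have kn : (k < n)%N by exact: leq_ltn_trans ki (ltn_trans ij jn).
under eq_bigr do rewrite mulrBl.
rewrite sumrB (@sum_delta R R^o)// (@sum_delta R R^o)//.
by rewrite lerBrDl he.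
Qed.

Lemma gap_coefficients_convex (t : R) c d : 0 <= t <= 1 ->
  gap_coefficients n i c -> gap_coefficients n i d ->
  gap_coefficients n i (fun l => t * c l + (1 - t) * d l).
Proof.
move=> /andP[t0 t1] [c1 ch] [d1 dh]; have t1' : 0 <= 1 - t by rewrite subr_ge0.
split=> [l|h e he].
  apply: le_trans (ler_normD _ _) _; rewrite !normrM (ger0_norm t0) (ger0_norm t1').
  have := ler_wpM2l t0 (c1 l); have := ler_wpM2l t1' (d1 l); lra.
under eq_bigr do rewrite mulrDl -!mulrA.
rewrite big_split/= -!mulr_sumr.
have := ler_wpM2l t0 (ch h e he); have := ler_wpM2l t1' (dh h e he); lra.
Qed.

(** The combinations form a convex set of vectors of norm at least [e], which Mazur-Orlicz separates
    from 0. Read contrapositively: the absence of a functional is witnessed by bounded real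
    coefficients, which have limits along an ultrafilter. *)
Lemma gap_functional {X : normedModType R} (x : nat -> X) (e : R) :
  (i.+1 < n)%N ->
  (forall c, gap_coefficients n i c -> e <= `|\sum_(j < n) c j *: x j|) ->
  exists f : dual X, `|f| <= 1 /\
    forall j k, (k <= i)%N -> (i < j)%N -> (j < n)%N -> f (x k) + e <= f (x j).
Proof.
move=> i_n ce.
pose D := [set d | exists2 c, gap_coefficients n i c & d = \sum_(j < n) c j *: x j].
have [|||h [lh hle hD]] := @mazur_orlicz_convex R X _ D e (@sublinear_norm R X 1 ler01).
- by eexists; exists (fun l => (l == i.+1)%:R - (l == i)%:R); [exact: gap_coefficients_delta|].
- move=> t _ _ t01 [c cg ->] [d dg ->].
  exists (fun l => t * c l + (1 - t) * d l); first exact: gap_coefficients_convex.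
  rewrite !scaler_sumr -big_split/=; apply: eq_bigr => j _.
  by rewrite !scalerA -scalerDl.
- by move=> _ [c cg ->]; rewrite mul1r; exact: ce.
have [f [fh f1]] := linear_form_dual lh ler01 hle.
exists f; split=> // j k ki ij jn; rewrite !fh.
have kn : (k < n)%N by exact: leq_ltn_trans ki (ltn_trans ij jn).
have : e <= h (x j - x k).
  apply: hD; exists (fun l => (l == j)%:R - (l == k)%:R).
    exact: gap_coefficients_delta.
  under eq_bigr do rewrite scalerBl.
  by rewrite sumrB !sum_delta.
by rewrite lh.1 (linear_formN _ lh); lra.
Qed.

End GapCoefficients.

(** The given functionals need not be ultraproducts, so new ones are sought in each coordinate. If
    none exists at the cut [i] for a large set of [u], there are coefficients [c u] with a
    combination of norm below [e / 2]. Let [l] be their limit: [\sum_j l_j y_j] has norm at most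
    [e / 2 + e / 8], while [f i] is at least [e - e / 8] on it. *)
Lemma pattern_ultrapower {I : Type} (U : free_ultrafilter I) {R : realType}
    {X : normedModType R} (A : set X) (n : nat) (e : R) :
  0 < e -> pattern (set_ultrapower U A) n e -> pattern A n (e / 2).
Proof.
move=> e0 [y [f [Ay f1 fy]]].
have /choice[x xP] j : exists x : bounded_family I X,
    (forall u, A (x u)) /\ ultraclass U x = y j.
  by have [x xA xy] := Ay j; exists x.
have xA j : forall u, A (x j u) by have [] := xP j.
have xy j : ultraclass U (x j) = y j by have [] := xP j.
pose M := \sum_(j < n) `|x j|.
have M0 : 0 <= M by exact: sumr_ge0.
have gP i : (i < n)%N -> ultra_sets U [set u | exists g : dual X, `|g| <= 1 /\
    forall j k, (k <= i)%N -> (i < j)%N -> (j < n)%N -> g (x k u) + e / 2 <= g (x j u)].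
  move=> _; have [i_n|n_i] := ltnP i.+1 n; last first.
    apply: nearW => u; exists 0; split; first by rewrite normr0.
    by move=> j k _ ij jn; have := leq_trans (leq_ltn_trans ij jn) n_i; rewrite ltnn.
  have [//|bad] := in_ultra_setVsetC [set u | exists g : dual X, `|g| <= 1 /\
    forall j k, (k <= i)%N -> (i < j)%N -> (j < n)%N -> g (x k u) + e / 2 <= g (x j u)]
    (ultra_sets_ultra U).
  (* The default 0 outside the bad set keeps the coefficients bounded by 1 for every [u]. *)
  exfalso; have /choice[c cP] u : exists c : nat -> R, (forall j, `|c j| <= 1) /\
      (~ (exists g : dual X, `|g| <= 1 /\ forall j k, (k <= i)%N -> (i < j)%N ->
          (j < n)%N -> g (x k u) + e / 2 <= g (x j u)) ->
        gap_coefficients n i c /\ `|\sum_(j < n) c j *: x j u| < e / 2).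
    have [g|ng] := pselect (exists g : dual X, `|g| <= 1 /\ forall j k, (k <= i)%N ->
          (i < j)%N -> (j < n)%N -> g (x k u) + e / 2 <= g (x j u)).
      by exists (fun=> 0); split=> [j|//]; rewrite normr0.
    apply: contrapT => nc; apply: ng.
    apply: (@gap_functional R n i X (fun j => x j u)) => // c cg.
    rewrite leNgt; apply/negP => ce; apply: nc; exists c; split; first exact: cg.1.
    by move=> _.
  have [l lP] := @ultra_cvg_seq R I (ultra_sets U) _ n c 1 (fun u => (cP u).1).
  (* An error [d] in each coefficient moves the combinations by at most [e / 8]. *)
  pose d := e / (8 * (M + 1)).
  have d0 : 0 < d by rewrite divr_gt0// mulr_gt0// ltr_wpDl.
  have dM : d * M <= e / 8.
    rewrite /d mulrAC ler_pdivrMr ?mulr_gt0 ?ltr_wpDl//.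
    have -> : e / 8 * (8 * (M + 1)) = e * (M + 1) by field.
    by rewrite ler_wpM2l ?(ltW e0)// lerDl.
  have close u (z : nat -> X) : (forall j, `|z j| <= `|x j|) ->
     (forall j, (j < n)%N -> `|c u j - l j| < d) ->
     `|\sum_(j < n) (c u j - l j) *: z j| <= e / 8.
    move=> zx cl; apply: le_trans (ler_norm_sum _ _ _) (le_trans _ dM).
    rewrite /M mulr_sumr; apply: ler_sum => j _; rewrite normrZ.
    by apply: ler_pM => //; exact/ltW/cl.
  have lU : `|\sum_(j < n) l j *: y j| <= e / 2 + e / 8.
    under eq_bigr do rewrite -xy -linearZ/=.
    rewrite -linear_sum/=; apply: ultra_norm_le; first by rewrite addr_ge0 ?divr_ge0 ?ltW.
    apply: filterS2 bad (lP d d0) => u /(cP u).2[_ cu] cl; rewrite bounded_family_sum.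
    have -> : \sum_(j < n) l j *: x j u = \sum_(j < n) c u j *: x j u -
        \sum_(j < n) (c u j - l j) *: x j u.
      by rewrite -sumrB; apply: eq_bigr => j _; rewrite -scalerBl opprB addrC subrK.
    apply: le_trans (ler_normB _ _) _; apply: lerD; first exact: ltW.
    by apply: (close u (fun j => x j u)) => // j; exact: sup_norm_ub.
  have [u [/(cP u).2[[_ cg] _] cl]] := filter_ex (filterI bad (lP d d0)).
  have := cg (fun j => f i (y j)) e (fun j k ki ij jn => fy i j k ki ij jn).
  rewrite -(linear_form_sum _ _ _ (dual_linear_form (f i))).
  have -> : \sum_(j < n) c u j *: y j = \sum_(j < n) l j *: y j +
        \sum_(j < n) (c u j - l j) *: y j.
    by rewrite -big_split/=; apply: eq_bigr => j _; rewrite -scalerDl addrC subrK.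
  rewrite dualD => h.
  have h1 := dual_le1 (f1 i) lU.
  have h2 : `|f i (\sum_(j < n) (c u j - l j) *: y j)| <= e / 8.
    apply: dual_le1 => //; apply: le_trans (ler_norm_sum _ _ _) (le_trans _ dM).
    rewrite /M mulr_sumr; apply: ler_sum => j _; rewrite normrZ.
    apply: ler_pM => //; [exact/ltW/cl|rewrite -xy; exact: ultra_norm_lb].
  by move: h1 h2; rewrite !ler_norml; lra.
have [u uP] := filter_ex (ultra_near_forall_lt gP).
have /choice[g gu] i : exists g : dual X, `|g| <= 1 /\ ((i < n)%N -> forall j k,
    (k <= i)%N -> (i < j)%N -> (j < n)%N -> g (x k u) + e / 2 <= g (x j u)).
  have [i_n|n_i] := ltnP i n; first by have [g [g1 gP']] := uP i i_n; exists g.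
  by exists 0; rewrite normr0.
exists (fun j => x j u), g; split=> // i; first by have [] := gu i.
move=> j k ki ij jn; have [_] := gu i; apply=> //; exact: ltn_trans ij jn.
Qed.

(** * Uniform approximation by convex combinations *)

Lemma bounded_family_eq {I : Type} {R : realType} {X : normedModType R}
  (x y : bounded_family I X) : (forall i, x i = y i) -> x = y.
Proof. by move=> xy; apply/val_inj/funext. Qed.

Section Mean.
Context {S : Type} {R : realType}.
Local Notation E := (bounded_family S R).
Implicit Types (u h s : E) (mu : E -> R).

(** A finitely additive probability on [S], as a functional: the inequality, applied to [h] and
    [- h], contains both positivity and normalization. *)
Definition mean mu :=
  linear_form mu /\ forall h N, (forall a, h a <= N) -> mu h <= N.

Lemma bounded_mul_subproof u h a : `|u a * h a| <= `|u| * `|h|.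
Proof. by rewrite normrM; apply: ler_pM => //; exact: sup_norm_ub. Qed.

Definition bounded_mul u h : E := mk_bounded_family (@bounded_mul_subproof u h).

Lemma mean_le mu u h : mean mu -> (forall a, u a <= h a) -> mu u <= mu h.
Proof.
move=> [lm mN] uh; rewrite -subr_le0 -linear_formN// -lm.1; apply: mN => a.
by rewrite -[(u - h) a]/(u a - h a) subr_le0.
Qed.

Lemma mean_gt0_ex mu u : mean mu -> 0 < mu u -> exists a, 0 < u a.
Proof.
move=> [lm mN] u0; apply: contrapT => nu; move: u0; apply/negP; rewrite -leNgt.
by apply: mN => a; rewrite leNgt; apply/negP => ua; apply: nu; exists a.
Qed.

(** Linear forms dominated by this functional are means, which lets Mazur-Orlicz construct them. *)
Lemma bounded_family_sup_sublinear (a0 : S) :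
  sublinear (fun h : E => sup (range h)).
Proof.
have rs (h : E) : has_sup (range h).
  split; first by exists (h a0), a0.
  by exists `|h| => _ [a _ <-]; apply: le_trans (ler_norm _) (sup_norm_ub _ _).
have sub (h : E) a : h a <= sup (range h).
  by apply: sup_upper_bound; [exact: rs|exists a].
have lub (h : E) N : (forall a, h a <= N) -> sup (range h) <= N.
  by move=> hN; apply: ge_sup; [exact: (rs h).1|move=> _ [a _ <-]].
split=> [u h|t h]; first by apply: lub => a; exact: lerD (sub _ _) (sub _ _).
rewrite le_eqVlt => /predU1P[<-|t0].
  rewrite scale0r mul0r; apply/le_anti; rewrite lub//=.
  exact: (sub 0 a0).
apply/le_anti/andP; split.
  by apply: lub => a; rewrite -[(t *: h) a]/(t * h a) ler_wpM2l ?(ltW t0).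
rewrite -ler_pdivlMl//; apply: lub => a; rewrite ler_pdivlMl//.
exact: (sub (t *: h) a).
Qed.

Lemma bounded_mulDr u s h : bounded_mul u (s + h) = bounded_mul u s + bounded_mul u h.
Proof. by apply: bounded_family_eq => a; exact: mulrDr. Qed.

Lemma bounded_mulDl u s h : bounded_mul (s + h) u = bounded_mul s u + bounded_mul h u.
Proof. by apply: bounded_family_eq => a; exact: mulrDl. Qed.

Lemma mean_square mu u s (t : R) : mean mu -> (forall a, 0 <= u a) ->
  2 * t * mu (bounded_mul u s) <=
  mu (bounded_mul (bounded_mul u s) s) + t ^+ 2 * mu u.
Proof.
move=> mm u0; have lm := mm.1; rewrite -!lm.2 -lm.1; apply: mean_le => // a.
change (2 * t * (u a * s a) <= u a * s a * s a + t ^+ 2 * u a).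
have := mulr_ge0 (u0 a) (sqr_ge0 (s a - t)); nra.
Qed.

(* Bessel's inequality for the form [(s, t) |-> mu (u s t)]: vectors whose product
   with [1] stays above [c] cannot be asymptotically orthogonal. *)
Lemma mean_correlated mu (V : set_system nat) (h : nat -> E) u (B c : R) :
  UltraFilter V -> mean mu -> (forall i a, 0 <= h i a <= B) ->
  (forall a, 0 <= u a) -> 0 < c ->
  (\forall i \near V, c <= mu (bounded_mul u (h i))) ->
  \forall i \near V, exists2 d, 0 < d &
    \forall j \near V, d <= mu (bounded_mul (bounded_mul u (h i)) (h j)).
Proof.
move=> VU mm hB u0 c0 uc; have lm := mm.1; pose N := `|u| * B * B + 1.
pose bad i := forall d, 0 < d ->
  \forall j \near V, mu (bounded_mul (bounded_mul u (h i)) (h j)) < d.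
have [Vg|Vb] := in_ultra_setVsetC [set i | exists2 d, 0 < d &
    \forall j \near V, d <= mu (bounded_mul (bounded_mul u (h i)) (h j))] VU; first exact: Vg.
exfalso; have {}Vb : \forall i \near V, bad i.
  apply: filterS Vb => i ni d d0.
  have [Vd|] := in_ultra_setVsetC
    [set j | mu (bounded_mul (bounded_mul u (h i)) (h j)) < d] VU; first exact: Vd.
  move=> Vd; exfalso; apply: ni; exists d => //; apply: filterS Vd => j /=.
  by move/negP; rewrite -leNgt.
have N1 : 1 <= N.
  rewrite /N lerDr.
  have [i _] := filter_ex uc; have [[a _]|nS] := pselect (exists a : S, True).
    have /andP[h0 h1] := hB i a; have B0 := le_trans h0 h1.
    by rewrite !mulr_ge0.
  have -> : u = 0 by apply: bounded_family_eq => a; exfalso; apply: nS; exists a.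
  by rewrite normr0 !mul0r.
(* As long as pairs are nearly orthogonal, [m] of the [h j] add up to an [s] for which [mu (u s)] is
   at least [m c] and [mu (u s^2)] grows only linearly. In [N], the term [|u| B^2] bounds the new
   square and 1 the two cross terms, each below 1/2. *)
have stack (m : nat) : exists s, [/\ m%:R * c <= mu (bounded_mul u s),
    mu (bounded_mul (bounded_mul u s) s) <= m%:R * N &
    forall d, 0 < d -> \forall j \near V, mu (bounded_mul (bounded_mul u s) (h j)) < d].
  elim: m => [|m [s [s1 s2 s3]]].
    have z (v w : E) : bounded_mul (bounded_mul v 0) w = 0.
      by apply: bounded_family_eq => a; change (v a * 0 * w a = 0); rewrite mulr0 mul0r.
    have z' (v : E) : bounded_mul v 0 = 0.
      by apply: bounded_family_eq => a; change (v a * 0 = 0); rewrite mulr0.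
    exists 0; split; first by rewrite z' linear_form0// mul0r.
      by rewrite z linear_form0// mul0r.
    by move=> d d0; apply: nearW => j; rewrite z linear_form0.
  have h1 : (0 : R) < 2^-1 by rewrite invr_gt0.
  have [j [[bj cj] sj]] := filter_ex (filterI (filterI Vb uc) (s3 _ h1)).
  exists (s + h j); rewrite !bounded_mulDr !bounded_mulDl !lm.1 -natr1; split.
  - by rewrite mulrDl mul1r lerD.
  - have -> : bounded_mul (bounded_mul u (h j)) s = bounded_mul (bounded_mul u s) (h j).
      by apply: bounded_family_eq => a; exact: mulrAC.
    have : mu (bounded_mul (bounded_mul u (h j)) (h j)) <= `|u| * B * B.
      apply: mm.2 => a; change (u a * h j a * h j a <= `|u| * B * B).
      have /andP[ha0 haB] := hB j a.
      have uu : u a <= `|u| by apply: le_trans (ler_norm _) (sup_norm_ub _ _).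
      by rewrite !ler_pM// ?mulr_ge0.
    by rewrite mulrDl mul1r /N; move: s2; rewrite /N; lra.
  - move=> d d0; have d2 : 0 < d / 2 by rewrite divr_gt0.
    apply: filterS2 (s3 _ d2) (bj _ d2) => k; rewrite bounded_mulDl lm.1; lra.
(* This [t] turns [2 t m c] into [2 m N], of which the square takes [m N]; [m] is chosen above the
   remaining [t^2 mu u]. *)
pose t := N / c; have t0 : 0 < t by rewrite divr_gt0// (lt_le_trans _ N1).
pose m := (Num.truncn (t ^+ 2 * mu u)).+1.
have mt : t ^+ 2 * mu u < m%:R.
  by rewrite /m; apply: truncnS_gt.
have [s [s1 s2 _]] := stack m.
have := mean_square s t mm u0.
have : 2 * t * (m%:R * c) <= 2 * t * mu (bounded_mul u s).
  by rewrite ler_wpM2l// mulr_ge0// ltW.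
have -> : 2 * t * (m%:R * c) = 2 * m%:R * N.
  by rewrite /t; field; rewrite gt_eqF.
have : m%:R <= m%:R * N by rewrite ler_peMr.
lra.
Qed.

End Mean.

Definition convex_weights {R : realType} (J : set nat) (n : nat) (w : nat -> R) :=
  [/\ forall i, 0 <= w i, forall i, ~ J i -> w i = 0,
      forall i, (n <= i)%N -> w i = 0 & \sum_(i < n) w i = 1].

Lemma sum_widen {R : realType} {E : lmodType R} (h : nat -> E) (w : nat -> R) n m :
  (n <= m)%N -> (forall i, (n <= i)%N -> w i = 0) ->
  \sum_(i < m) w i *: h i = \sum_(i < n) w i *: h i.
Proof.
move=> /subnKC <- w0; elim: (m - n)%N => [|k IH]; first by rewrite addn0.
by rewrite addnS big_ord_recr/= IH w0 ?leq_addr// scale0r addr0.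
Qed.

Lemma convex_weights_delta {R : realType} (J : set nat) i :
  J i -> convex_weights J i.+1 (fun j => (j == i)%:R : R).
Proof.
move=> Ji; split=> [j|j nJ|j ij|]; first exact: ler0n.
- by case: eqP => // ji; rewrite ji in nJ.
- by rewrite gtn_eqF.
- rewrite -[RHS](@sum_delta R R^o i.+1 i (fun=> 1) (ltnSn i)).
  by apply: eq_bigr => j _; rewrite -[_ *: _]/(_ * 1) mulr1.
Qed.

Lemma dual_limit {R : realType} {X : normedModType R} {T : Type} (V : set_system T)
    (F : T -> dual X) (M : R) : UltraFilter V -> 0 <= M -> (forall t, `|F t| <= M) ->
  exists g : dual X, `|g| <= M /\ forall x, (fun t => F t x) @ V --> g x.
Proof.
move=> VU M0 FM; pose h x := ulim V (fun t => F t x).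
have Fb x t : `|F t x| <= M * `|x|.
  by apply: le_trans (dual_le _ _) _; rewrite ler_wpM2r.
have hc x : (fun t => F t x) @ V --> h x by exact: ulim_cvg.
have lh : linear_form h.
  split=> [x y|a x]; apply: cvg_ulim.
    apply: cvg_trans (cvgD (hc x) (hc y)).
    apply: near_eq_cvg; apply: nearW => t; exact: esym (dualD _ _ _).
  apply: cvg_trans (cvgM (cvg_cst a) (hc x)).
  apply: near_eq_cvg; apply: nearW => t; exact: esym (dualZ _ _ _).
have hM x : h x <= M * `|x|.
  apply: ultra_cvg_le (hc x) _; apply: nearW => t.
  exact: le_trans (ler_norm _) (Fb x t).
have [g [gh gM]] := linear_form_dual lh M0 hM.
by exists g; split=> // x; rewrite gh.
Qed.

Section UniformConvexCombinations.
Context {R : realType} {X : normedModType R} (A : set X) (M : R).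
Context (F : nat -> dual X) (F0 : dual X) (V : set_system nat) (VU : UltraFilter V).
Hypothesis AM : forall a, A a -> `|a| <= M.
Hypothesis Ac : relatively_weakly_compact A.
Hypothesis F1 : forall i, `|F i| <= 1.
Hypothesis FV : forall x, (fun i => F i x) @ V --> F0 x.
Hypothesis Vinfty : forall n, \forall i \near V, (n <= i)%N.
Variable (e : R).
Hypothesis e0 : 0 < e.

Local Notation S := {a : X | A a}.
Local Notation E := (bounded_family S R).

(** Truncation at [e / 2] makes a product of deviations positive only at points where every one of
    its functionals is off by more than [e / 2]. *)
Let deviation i (a : X) : R := Num.max (`|F i a - F0 a| - e / 2) 0.

Let deviation_ge0 i a : 0 <= deviation i a.
Proof. by rewrite le_max lexx orbT. Qed.

Let deviation_bound i (a : S) : `|deviation i (sval a)| <= M + `|F0| * M.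
Proof.
rewrite ger0_norm// ge_max; have aM := AM (svalP a).
have h1 := dual_le1 (F1 i) aM.
have h2 : `|F0 (sval a)| <= `|F0| * M.
  by apply: le_trans (dual_le _ _) _; rewrite ler_wpM2l.
apply/andP; split; last first.
  have M0 : 0 <= M by exact: le_trans aM.
  by rewrite addr_ge0// mulr_ge0.
have := ler_normB (F i (sval a)) (F0 (sval a)); have := e0; lra.
Qed.

Let dev i : E := mk_bounded_family (deviation_bound i).

Let prods (s : seq nat) : E :=
  foldr (fun i u => bounded_mul u (dev i))
        (mk_bounded_family (fun a : S => lexx `|1 : R|)) s.

Let prods_ge0 s a : 0 <= prods s a.
Proof. by elim: s => [|i s IH] /=; [exact: ler01|exact: mulr_ge0]. Qed.

Let prods_gt0 s (a : S) i : 0 < prods s a -> i \in s ->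
  e / 2 < `|F i (sval a) - F0 (sval a)|.
Proof.
elim: s => [//|j s IH] /= u0; change (is_true (0 < prods s a * deviation j (sval a))) in u0.
have s0 : 0 < prods s a.
  by rewrite lt_neqAle prods_ge0 andbT; apply/eqP => h; rewrite -h mul0r ltxx in u0.
rewrite inE => /predU1P[->|]; last exact: IH.
by move: u0; rewrite pmulr_rgt0// lt_max ltxx orbF subr_gt0.
Qed.

(** A state lists the indices and the points chosen so far. The invariant keeps the product of the
    chosen deviations correlated with [V]-almost every further one, which lets the selection go on
    forever. *)
Let chain (mu : E -> R) (st : seq nat * seq X) :=
  exists2 c, 0 < c & \forall j \near V, c <= mu (bounded_mul (prods st.1) (dev j)).

Let extends (st st' : seq nat * seq X) := exists i (a : S),
  [/\ st' = (i :: st.1, sval a :: st.2),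
      forall x, x \in st.2 -> `|F i x - F0 x| <= e / 4 &
      0 < prods (i :: st.1) a].

Let chain_extends mu st : mean mu -> chain mu st ->
  exists st', chain mu st' /\ extends st st'.
Proof.
move=> mm [c c0 uc]; have devB i a : 0 <= dev i a <= M + `|F0| * M.
  by apply/andP; split; [exact: deviation_ge0|
     apply: le_trans (ler_norm _) (deviation_bound _ _)].
have := mean_correlated VU mm devB (prods_ge0 st.1) c0 uc.
have close : \forall i \near V, forall x, x \in st.2 -> `|F i x - F0 x| <= e / 4.
  have e4 : 0 < e / 4 by rewrite divr_gt0.
  elim: st.2 => [|x xs IH]; first exact: nearW.
  apply: filterS2 (ultra_cvg_near (@FV x) e4) IH => i Fx IH y.
  by rewrite inE => /predU1P[->|]; [exact: ltW|exact: IH].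
move=> /(filterI uc)/(filterI close)/filter_ex[i [ic [ci [d d0 di]]]].
have [a a0] := mean_gt0_ex mm (lt_le_trans c0 ci).
exists (i :: st.1, sval a :: st.2); split; first by exists d.
by exists i, a.
Qed.

(** A double limit argument. An endless selection has [|F (i l) - F0| > e / 2] at [x k] for
    [l <= k], and [|F (i k) - F0| <= e / 4] at [x l] for [l < k]. For a weak limit [y] of the points
    and a pointwise limit [G] of the functionals, the two orders of passing to the limit give
    contradictory bounds on [|G y - F0 y|]. *)
Let no_chain mu : mean mu -> ~ chain mu ([::], [::]).
Proof.
move=> mm ch; have [|f [f0 fS]] := @dependent_choice _
    (fun st st' => chain mu st -> chain mu st' /\ extends st st') _ ([::], [::]).
  move=> st; apply: cid; have [c|nc] := pselect (chain mu st); last by exists st.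
  by have [st' h] := chain_extends mm c; exists st'.
have fc n : chain mu (f n) by elim: n => [|n IH]; [rewrite f0|exact: (fS n IH).1].
have /choice[i /choice[x ixP]] n : exists i, exists a : S,
    [/\ f n.+1 = (i :: (f n).1, sval a :: (f n).2),
      forall x, x \in (f n).2 -> `|F i x - F0 x| <= e / 4 &
      0 < prods (i :: (f n).1) a].
  by have [_ [i [a h]]] := fS n (fc n); exists i, a.
have mem_i l k : (l <= k)%N -> i l \in (f k.+1).1.
  elim: k => [|k IH].
    by rewrite leqn0 => /eqP->; have [-> _ _] := ixP 0%N; rewrite mem_head.
  rewrite leq_eqVlt => /predU1P[->|]; first by have [-> _ _] := ixP k.+1; rewrite mem_head.
  by rewrite ltnS => /IH h; have [-> _ _] := ixP k.+1; rewrite inE h orbT.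
have mem_x l k : (l < k)%N -> sval (x l) \in (f k).2.
  elim: k => [//|k IH]; rewrite ltnS leq_eqVlt => /predU1P[->|/IH h].
    by have [-> _ _] := ixP k; rewrite mem_head.
  by have [-> _ _] := ixP k; rewrite inE h orbT.
have far l k : (l <= k)%N -> e / 2 < `|F (i l) (sval (x k)) - F0 (sval (x k))|.
  move=> lk; have [fk _ u0] := ixP k; apply: (prods_gt0 u0).
  by have := mem_i l k lk; rewrite fk.
have near l k : (l < k)%N -> `|F (i k) (sval (x l)) - F0 (sval (x l))| <= e / 4.
  by move=> lk; have [_ h _] := ixP k; exact/h/mem_x.
have [y xy] := rel_weakly_compact_limit Ac VU (fun k => svalP (x k)).
have [G [_ FG]] := @dual_limit R X nat V (fun k => F (i k)) 1 VU ler01 (fun k => F1 _).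
have cvgB (g g' : dual X) : (fun k => `|g (sval (x k)) - g' (sval (x k))|) @ V -->
    `|g y - g' y| by apply: cvg_norm; apply: cvgB; exact: xy.
have Gnear : `|G y - F0 y| <= e / 4.
  apply: ultra_cvg_le (cvgB G F0) _; apply: nearW => l.
  have : (fun k => `|F (i k) (sval (x l)) - F0 (sval (x l))|) @ V -->
      `|G (sval (x l)) - F0 (sval (x l))|.
    by apply: cvg_norm; apply: pseudometric_normed_Zmodule.cvgB; [exact: FG|exact: cvg_cst].
  move/ultra_cvg_le; apply; apply: filterS (Vinfty l.+1) => k; exact: near.
have : e / 2 <= `|G y - F0 y|.
  have : (fun k => `|F (i k) y - F0 y|) @ V --> `|G y - F0 y|.
    by apply: cvg_norm; apply: pseudometric_normed_Zmodule.cvgB; [exact: FG|exact: cvg_cst].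
  move/ultra_cvg_ge; apply; apply: nearW => l.
  apply: ultra_cvg_ge (cvgB (F (i l)) F0) _.
  by apply: filterS (Vinfty l) => k lk; exact/ltW/far.
by have := e0; lra.
Qed.

(** If each combination is off by more than [e] at some point, the same combination of deviations is
    at least [e / 2] there. Mazur-Orlicz turns this into one mean that is at least [e / 2] on all
    deviations with index in [J], and this starts a chain. *)
Lemma uniform_convex_combination (J : set nat) : V J ->
  exists n (w : nat -> R), convex_weights J n w /\
    forall a, A a -> `|\sum_(i < n) w i * F i a - F0 a| <= e.
Proof.
move=> VJ; apply: contrapT => nw.
have {}nw n w : convex_weights J n w ->
    exists a : S, e < `|\sum_(i < n) w i * F i (sval a) - F0 (sval a)|.
  move=> wP; apply: contrapT => na; apply: nw; exists n, w; split=> // a Aa.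
  by rewrite leNgt; apply/negP => h; apply: na; exists (exist _ a Aa).
have [j Jj] := filter_ex VJ.
have [a0 _] := nw _ _ (convex_weights_delta Jj).
pose D := [set d : E | exists n w, convex_weights J n w /\
  d = \sum_(i < n) w i *: dev i].
have e2 : 0 < e / 2 by rewrite divr_gt0.
have [|||mu [lmu mule muD]] := @mazur_orlicz_convex R E _ D (e / 2)
    (bounded_family_sup_sublinear a0).
- by eexists; exists j.+1, (fun i => (i == j)%:R); split; first exact: convex_weights_delta.
- move=> t _ _ /andP[t0 t1] [n [w [[w0 wJ wn w1] ->]]] [m [v [[v0 vJ vm v1] ->]]].
  have t1' : 0 <= 1 - t by rewrite subr_ge0.
  exists (maxn n m), (fun i => t * w i + (1 - t) * v i); split; first split.
  + by move=> i; rewrite addr_ge0// mulr_ge0.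
  + by move=> i nJ; rewrite wJ// vJ// !mulr0 addr0.
  + by move=> i; rewrite geq_max => /andP[ni mi]; rewrite wn// vm// !mulr0 addr0.
  + rewrite big_split/= -!mulr_sumr.
    have h k l (c : nat -> R) : (k <= l)%N -> (forall i, (k <= i)%N -> c i = 0) ->
        \sum_(i < l) c i = \sum_(i < k) c i.
      move=> /subnKC <- c0; elim: (l - k)%N => [|p IH]; first by rewrite addn0.
      by rewrite addnS big_ord_recr/= IH c0 ?leq_addr// addr0.
    rewrite (h _ _ _ (leq_maxl n m) wn) (h _ _ _ (leq_maxr n m) vm).
    by rewrite w1 v1; ring.
  + rewrite -(sum_widen _ (leq_maxl n m) wn) -(sum_widen _ (leq_maxr n m) vm).
    rewrite !scaler_sumr -big_split/=; apply: eq_bigr => i _.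
    by rewrite !scalerA -scalerDl.
- move=> _ [n [w [wP ->]]]; have [a ae] := nw _ _ wP.
  have [w0 _ _ w1] := wP.
  set d := \sum_(i < n) _.
  apply: (@le_trans _ _ (d a)); last first.
    apply: sup_upper_bound; last by exists a.
    split; first by exists (d a), a.
    by exists `|d| => _ [b _ <-]; apply: le_trans (ler_norm _) (sup_norm_ub _ _).
  rewrite /d bounded_family_sum.
  apply: (@le_trans _ _ (\sum_(i < n) w i * (`|F i (sval a) - F0 (sval a)| - e / 2))).
    under eq_bigr do rewrite mulrBr.
    rewrite sumrB -mulr_suml w1 mul1r lerBrDr -splitr.
    apply: le_trans (ltW ae) _.
    have -> : \sum_(i < n) w i * F i (sval a) - F0 (sval a) =
        \sum_(i < n) w i * (F i (sval a) - F0 (sval a)).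
      by under [RHS]eq_bigr do rewrite mulrBr; rewrite sumrB -mulr_suml w1 mul1r.
    apply: le_trans (ler_norm_sum _ _ _) _; apply: ler_sum => i _.
    by rewrite normrM ger0_norm.
  apply: ler_sum => i _; apply: ler_wpM2l => //.
  change (`|F i (sval a) - F0 (sval a)| - e / 2 <= deviation i (sval a)).
  by rewrite le_max lexx.
have mm : mean mu.
  split=> // h N hN; apply: le_trans (mule h) _; apply: ge_sup.
    by exists (h a0), a0.
  by move=> _ [a _ <-].
apply: (no_chain mm); exists (e / 2) => //; apply: filterS VJ => i Ji.
have -> : bounded_mul (prods [::]) (dev i) = dev i.
  by apply: bounded_family_eq => a; change (1 * dev i a = dev i a); rewrite mul1r.
apply: muD; exists i.+1, (fun l => (l == i)%:R); split; first exact: convex_weights_delta.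
by rewrite sum_delta.
Qed.

End UniformConvexCombinations.

(** * Patterns in the bipolar *)

Lemma rapid_complete_cauchy {R : realType} {X : normedModType R} :
  rapid_complete X ->
  forall F : set_system X, ProperFilter F -> cauchy F -> cvg F.
Proof.
move=> cX F FF /cauchyP Fc; apply/cvg_ex.
have half n : 0 < 2^-1 ^+ n :> R by rewrite exprn_gt0// invr_gt0.
have half4 n : 0 < 2^-1 ^+ n / 2 :> R by rewrite divr_gt0.
have /choice[a aP] n : exists a : X, \forall y \near F, `|a - y| < 2^-1 ^+ n / 2.
  have [a Fa] := Fc _ (half4 n); exists a; apply: filterS Fa => y.
  by rewrite -ball_normE.
have [|y ya] := cX a.
  move=> n; have [z [az an]] := filter_ex (filterI (aP n.+1) (aP n)).
  rewrite -[a n.+1](subrK z) -addrA; apply: le_trans (ler_normD _ _) _.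
  rewrite distrC in an; apply: le_trans (lerD (ltW az) (ltW an)) _.
  by rewrite exprS; have := half n; lra.
exists y; apply/cvgrPdist_lt => e e0.
have [n ne] := half_expn_small (divr_gt0 e0 (ltr0n R 3)).
apply: filterS (aP n) => z az.
rewrite -[y](subrK (a n)) -addrA; apply: le_lt_trans (ler_normD _ _) _.
have := ya n; have := half n; lra.
Qed.

(** Carrier and norm remain those of [X], so what is proved of [X] applies to the packed space as it
    is. *)
Definition banach_of {R : realType} (X : normedModType R) (cX : rapid_complete X) :
    completeNormedModType R :=
  HB.pack (NormedModule.sort X) (Uniform_isComplete.Build X (rapid_complete_cauchy cX)).

Lemma rapid_complete_dual {R : realType} {X : normedModType R} :
  rapid_complete (dual X).
Proof.
move=> f fh; have [U Un] := nat_free_ultrafilter.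
have fM n : `|f n| <= `|f 0%N| + 2.
  rewrite -[f n](subrK (f 0%N)) addrC; apply: le_trans (ler_normD _ _) _.
  by rewrite lerD2l; have := rapid_tail fh (leq0n n); rewrite expr0 mulr1.
have M0 : 0 <= `|f 0%N| + 2 by rewrite addr_ge0.
have [g [_ gf]] := dual_limit (ultra_sets_ultra U) M0 fM.
exists g => n; apply: dual_norm_le.
  by rewrite mulr_ge0// exprn_ge0// invr_ge0.
move=> x; have : (fun m => `|f m x - f n x|) @ ultra_sets U --> `|g x - f n x|.
  by apply: cvg_norm; apply: cvgB; [exact: gf|exact: cvg_cst].
move/ultra_cvg_le; apply; apply: filterS (Un n) => m nm.
apply: le_trans (dual_le (f m - f n) x) _.
by rewrite ler_wpM2r// rapid_tail.
Qed.

(** The uniform boundedness principle for evaluations at points of [A], on the dual, which is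
    complete whatever [X] is. *)
Lemma pointwise_bounded_bounded {R : realType} {X : normedModType R} (A : set X) :
  (forall f : dual X, exists M, forall a, A a -> `|f a| <= M) ->
  exists M, 0 <= M /\ forall a, A a -> `|a| <= M.
Proof.
move=> Af; pose D := banach_of (@rapid_complete_dual R X).
pose ev (a : X) : D -> R := fun f => (f : dual X) a.
have [||M MP] := @Banach_Steinhauss R D R [set ev a | a in A] _ _ 1.
- move=> _ [a _ <-]; split=> // r; exists (r * `|a|) => f fr.
  by apply: le_trans (dual_le (f : dual X) a) _; rewrite ler_wpM2r.
- by move=> f; have [M fM] := Af f; exists M => _ [a Aa <-]; exact: fM.
exists `|M|; split=> // a Aa; apply: norm_le_dual => f f1.
apply: le_trans (ler_norm _) (le_trans _ (ler_norm _)).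
by apply: (MP (ev a) _ f) => //; exists a.
Qed.

Lemma rel_weakly_compact_bounded {R : realType} {X : normedModType R} (A : set X) :
  relatively_weakly_compact A -> exists M, 0 <= M /\ forall a, A a -> `|a| <= M.
Proof.
move=> Ac; apply: pointwise_bounded_bounded => f; apply: contrapT => nf.
have /choice[a aP] n : exists a, A a /\ n%:R < `|f a|.
  apply: contrapT => na; apply: nf; exists n%:R => a Aa.
  by rewrite leNgt; apply/negP => h; apply: na; exists a.
have [U Un] := nat_free_ultrafilter.
have [y /(_ f)/cvg_norm ay] := rel_weakly_compact_limit Ac (ultra_sets_ultra U)
  (fun n => (aP n).1).
pose n := (Num.truncn (`|f y| )).+1.
have : n%:R <= `|f y|.
  apply: ultra_cvg_ge ay _; apply: filterS (Un n) => m nm.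
  by apply: le_trans (ltW (aP m).2); rewrite ler_nat.
by apply/negP; rewrite -ltNge truncnS_gt.
Qed.

(** Constant families carry [A] into its ultrapower without loss of norm. The boundedness of [K],
    which the definition does not include, comes from here. *)
Lemma ultra_rel_weakly_compact_bounded {I : Type} (U : free_ultrafilter I) {R : realType}
    {X : normedModType R} (A : set X) :
  relatively_weakly_compact (set_ultrapower U A) ->
  exists M, 0 <= M /\ forall a, A a -> `|a| <= M.
Proof.
move=> /rel_weakly_compact_bounded[M [M0 UM]]; exists M; split=> // a Aa.
apply: norm_le_dual => f f1.
have [g [g1 gP]] := ultra_functional U (fun _ : I => f1).
pose x := mk_bounded_family (fun _ : I => lexx `|a|).
have fg : f a <= g (ultraclass U x) by apply: ultra_cvg_ge (gP x) _; exact: nearW.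
apply: le_trans fg (le_trans (ler_norm _) _).
by apply: dual_le1 => //; apply: UM; exists x.
Qed.

(** The closed absolutely convex hull of [K], accessed only through bounds of functionals on [K].
    The condition [0 <= d] keeps 0 in the bipolar of the empty set. *)
Definition bipolar {R : realType} {X : normedModType R} (K : set X) : set X :=
  [set x | forall (f : dual X) d, 0 <= d -> (forall k, K k -> `|f k| <= d) -> `|f x| <= d].

Section Bipolar.
Context {R : realType} {X : normedModType R} (K : set X).

Lemma sub_bipolar : K `<=` bipolar K.
Proof. by move=> x Kx f d _; exact. Qed.

Lemma bipolar0 : bipolar K 0.
Proof. by move=> f d d0 _; rewrite linear0 normr0. Qed.

Lemma bipolar_abs_convex (s t : R) x y : `|s| + `|t| <= 1 ->
  bipolar K x -> bipolar K y -> bipolar K (s *: x + t *: y).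
Proof.
move=> st Kx Ky f d d0 fd; rewrite dualD !dualZ.
apply: le_trans (ler_normD _ _) _; rewrite !normrM.
have := ler_wpM2l (normr_ge0 s) (Kx f d d0 fd).
have := ler_wpM2l (normr_ge0 t) (Ky f d d0 fd).
have := ler_wpM2r d0 st; lra.
Qed.

Lemma bipolar_bound M : 0 <= M -> (forall k, K k -> `|k| <= M) ->
  forall x, bipolar K x -> `|x| <= M.
Proof.
move=> M0 KM x Kx; apply: norm_le_dual => f f1; apply: le_trans (ler_norm _) _.
by apply: Kx => // k Kk; apply: dual_le1 => //; exact: KM.
Qed.

Lemma dual_sumE (n : nat) (w : nat -> R) (f : nat -> dual X) (x : X) :
  (\sum_(i < n) w i *: f i) x = \sum_(i < n) w i * f i x.
Proof.
elim: n => [|n IHn]; first by rewrite !big_ord0.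
by rewrite !big_ord_recr/= -IHn.
Qed.

Lemma cvg_weighted_sum (V : set_system nat) (FV : Filter V) (n : nat) (w : nat -> R)
    (phi : nat -> nat -> R) (l : nat -> R) :
  (forall i, phi i @ V --> l i) ->
  (fun m => \sum_(i < n) w i * phi i m) @ V --> \sum_(i < n) w i * l i.
Proof.
move=> phil; elim: n => [|n IHn].
  rewrite big_ord0; under eq_fun do rewrite big_ord0; exact: cvg_cst.
rewrite big_ord_recr/=; under eq_fun do rewrite big_ord_recr/=.
by apply: cvgD => //; apply: cvgM => //; exact: cvg_cst.
Qed.

Lemma convex_sum_ge (J : set nat) n (w v : nat -> R) (b : R) :
  convex_weights J n w -> (forall i, J i -> (i < n)%N -> b <= v i) ->
  b <= \sum_(i < n) w i * v i.
Proof.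
move=> [w0 wJ _ w1] bv; rewrite -[b]mul1r -w1 mulr_suml; apply: ler_sum => i _.
have [Ji|nJ] := pselect (J i); first by rewrite ler_wpM2l// bv.
by rewrite wJ// !mul0r.
Qed.

Lemma convex_sum_le (J : set nat) n (w v : nat -> R) (b : R) :
  convex_weights J n w -> (forall i, J i -> v i <= b) ->
  \sum_(i < n) w i * v i <= b.
Proof.
move=> [w0 wJ _ w1] bv; rewrite -[b]mul1r -w1 mulr_suml; apply: ler_sum => i _.
have [Ji|nJ] := pselect (J i); first by rewrite ler_wpM2l// bv.
by rewrite wJ// !mul0r.
Qed.

(** One block of indices lies below [n], the other starts at [n], and both averages are close to
    [F0] on [K^U]. The class [z n] of the [n]-th pattern points lies above every cut of the first
    block and below every cut of the second, which forces the averages apart at [z n]. *)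
Lemma bipolar_no_pattern :
  (forall U : free_ultrafilter nat, relatively_weakly_compact (set_ultrapower U K)) ->
  forall e, 0 < e -> exists n, ~ pattern (bipolar K) n e.
Proof.
move=> Kc e e0; apply: contrapT => npat.
have [U Un] := nat_free_ultrafilter; have UU := ultra_sets_ultra U.
have [M [M0 KM]] := ultra_rel_weakly_compact_bounded (Kc U).
have /choice[y /choice[f yfP]] n : exists y, exists f : nat -> dual X,
    [/\ forall j, bipolar K (y j), forall i, `|f i| <= 1 &
        forall i j k, (k <= i)%N -> (i < j)%N -> (j < n)%N -> f i (y k) + e <= f i (y j)].
  by apply: contrapT => h; apply: npat; exists n.
have f1 n i : `|f n i| <= 1 by have [_ h _] := yfP n; exact: h.
have yK n j : bipolar K (y n j) by have [h _ _] := yfP n; exact: h.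
have yM j n : `|y n j| <= M by apply: bipolar_bound (yK n j).
have gap i j k : (k <= i)%N -> (i < j)%N ->
    \forall n \near ultra_sets U, f n i (y n k) + e <= f n i (y n j).
  move=> ki ij; apply: filterS (Un j.+1) => n jn.
  by have [_ _] := yfP n; exact.
have /choice[F FP] i := ultra_functional U (fun n => f1 n i).
have F1 i : `|F i| <= 1 by have [] := FP i.
have Fc i (x : bounded_family nat X) :
    (fun n => f n i (x n)) @ ultra_sets U --> F i (ultraclass U x).
  by have [_] := FP i; exact.
have [F0 [_ FU]] := dual_limit UU ler01 F1.
pose z j := mk_bounded_family (yM j); pose v i j := F i (ultraclass U (z j)).
have vc i j : (fun n => f n i (y n j)) @ ultra_sets U --> v i j by exact: Fc i (z j).
have vM i j : `|v i j| <= M.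
  apply: dual_le1 => //; apply: le_trans (ultra_norm_lb _ _) _.
  by apply: sup_norm_lub => // n; exact: yM.
have vgap i j k : (k <= i)%N -> (i < j)%N -> v i k + e <= v i j.
  move=> ki ij; rewrite -lerBrDl; apply: ultra_cvg_ge (cvgB (vc i j) (vc i k)) _.
  by apply: filterS (gap i j k ki ij) => n; rewrite -lerBrDl.
(* [a i] is the level of the lower side of the cut [i], whose upper side lies above [a i + e].
   Levels vary with [i], so blocks are taken among indices whose level is within [e / 8] of the
   limit [b]. *)
pose a i := sup [set v i k | k in [set k | (k <= i)%N]].
have asup i : has_sup [set v i k | k in [set k | (k <= i)%N]].
  split; first by exists (v i 0%N), 0%N.
  by exists M => _ [k _ <-]; apply: le_trans (ler_norm _) (vM _ _).
have va i k : (k <= i)%N -> v i k <= a i.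
  by move=> ki; apply: sup_upper_bound; [exact: asup|exists k].
have av i j : (i < j)%N -> a i + e <= v i j.
  move=> ij; rewrite -lerBrDr; apply: ge_sup; first exact: (asup i).1.
  by move=> _ [k ki <-]; rewrite lerBrDr; exact: vgap.
have aM i : `|a i| <= M.
  rewrite ler_norml; apply/andP; split.
    by apply: le_trans (va i 0%N isT); have := vM i 0%N; rewrite ler_norml => /andP[].
  apply: ge_sup; first exact: (asup i).1.
  by move=> _ [k ki <-]; apply: le_trans (ler_norm _) (vM _ _).
pose b := ulim (ultra_sets U) a.
have e8 : 0 < e / 8 by rewrite divr_gt0.
have Jb : \forall i \near ultra_sets U, `|a i - b| < e / 8.
  exact: ultra_cvg_near (ulim_cvg aM) e8.
have KUM c : set_ultrapower U K c -> `|c| <= M.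
  move=> [x xK <-]; apply: le_trans (ultra_norm_lb _ _) _.
  by apply: sup_norm_lub => // i; exact/KM/xK.
have [n [w [wP wF]]] := uniform_convex_combination UU KUM (Kc U) F1 FU Un e8 Jb.
have [n' [w' [wP' wF']]] := uniform_convex_combination UU KUM (Kc U) F1 FU Un e8
  (filterI Jb (Un n)).
pose h m : dual X := \sum_(i < n) w i *: f m i - \sum_(i < n') w' i *: f m i.
have hE m x : h m x = \sum_(i < n) w i * f m i x - \sum_(i < n') w' i * f m i x.
  by rewrite -!dual_sumE.
pose H c := \sum_(i < n) w i * F i c - \sum_(i < n') w' i * F i c.
have hc (x : bounded_family nat X) :
    (fun m => h m (x m)) @ ultra_sets U --> H (ultraclass U x).
  under eq_fun do rewrite hE.
  have hs k (u : nat -> R) : (fun m => \sum_(i < k) u i * f m i (x m)) @ ultra_sets U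
      --> \sum_(i < k) u i * F i (ultraclass U x).
    exact: (@cvg_weighted_sum (ultra_sets U) _ k u (fun i m => f m i (x m))
      (fun i => F i (ultraclass U x)) (fun i => Fc i x)).
  exact: cvgB (hs n w) (hs n' w').
(* If this failed on a large set, offending points of [K] would form a class in [K^U] with [|H|] at
   least [e / 2], whereas the two averages are within [e / 8 + e / 8] of each other there. *)
have hK : \forall m \near ultra_sets U, forall k, K k -> `|h m k| <= e / 2.
  have [//|bad] := in_ultra_setVsetC [set m | forall k, K k -> `|h m k| <= e / 2] UU.
  exfalso.
  have ex m : ~ (forall k, K k -> `|h m k| <= e / 2) -> exists k, K k /\ e / 2 < `|h m k|.
    move=> /existsNP[k /not_implyP[Kk /negP]]; rewrite -ltNge => hk.
    by exists k.
  have [m0 /ex[k0 [Kk0 _]]] := filter_ex bad.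
  have /choice[x xP] m : exists k, K k /\
      (~ (forall k, K k -> `|h m k| <= e / 2) -> e / 2 < `|h m k|).
    have [g|/[dup] ng /ex[k [Kk hk]]] := pselect (forall k, K k -> `|h m k| <= e / 2).
      by exists k0.
    by exists k.
  pose xf := mk_bounded_family (fun m => KM _ (xP m).1).
  have cK : set_ultrapower U K (ultraclass U xf) by exists xf => // m; exact: (xP m).1.
  have : e / 2 <= `|H (ultraclass U xf)|.
    apply: ultra_cvg_ge (cvg_norm (hc xf)) _; apply: filterS bad => m /(xP m).2.
    exact: ltW.
  have := wF _ cK; have := wF' _ cK; set c := ultraclass U xf.
  have -> : H c = \sum_(i < n) w i * F i c - F0 c - (\sum_(i < n') w' i * F i c - F0 c).
    by rewrite /H; ring.
  move=> h1 h2; apply/negP; rewrite -ltNge; apply: le_lt_trans (ler_normB _ _) _; lra.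
(* The only passage from [K] to its bipolar: the bound on [K] holds at the pattern points [y m n] by
   definition of [bipolar]. *)
have Hz : `|H (ultraclass U (z n))| <= e / 2.
  apply: ultra_cvg_le (cvg_norm (hc (z n))) _; apply: filterS hK => m hm.
  by apply: yK => //; rewrite divr_ge0 ?(ltW e0).
have low : b - e / 8 + e <= \sum_(i < n) w i * v i n.
  apply: (@convex_sum_ge _ n w (fun i => v i n) _ wP) => i /= Ji i_n; apply: le_trans (av i n i_n).
  by rewrite lerD2r; move: Ji; rewrite ltr_norml => /andP[]; lra.
have high : \sum_(i < n') w' i * v i n <= b + e / 8.
  apply: (@convex_sum_le _ n' w' (fun i => v i n) _ wP') => i /= [Ji ni]; apply: le_trans (va i n ni) _.
  by move: Ji; rewrite ltr_norml => /andP[]; lra.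
move: Hz; rewrite /H -/(v _ _) ler_norml => /andP[_].
change (\sum_(i < n) w i * v i n - \sum_(i < n') w' i * v i n <= e / 2 -> False).
move: low high; have := e0; lra.
Qed.

End Bipolar.

(** * The interpolation space *)

Definition seminorm {R : realType} {E : lmodType R} (p : E -> R) :=
  (forall x y, p (x + y) <= p x + p y) /\ (forall t x, p (t *: x) = `|t| * p x).

Section Seminorm.
Context {R : realType} {E : lmodType R} (p : E -> R).
Hypothesis sp : seminorm p.

Lemma seminorm0 : p 0 = 0.
Proof. by rewrite -(scale0r 0) sp.2 normr0 mul0r. Qed.

Lemma seminormN x : p (- x) = p x.
Proof. by rewrite -scaleN1r sp.2 normrN normr1 mul1r. Qed.

Lemma seminorm_ge0 x : 0 <= p x.
Proof. by have := sp.1 x (- x); rewrite subrr seminorm0 seminormN; lra. Qed.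

Lemma seminorm_sublinear : sublinear p.
Proof. by split=> [|t x t0]; [exact: sp.1|rewrite sp.2 ger0_norm]. Qed.

End Seminorm.

(** * Finite l2-norms of segments of a sequence *)

Section L2.
Context {R : realType}.
Implicit Types a b c : nat -> R.

Definition l2 a (m n : nat) : R := Num.sqrt (\sum_(m <= k < n) a k ^+ 2).

Lemma l2_ge0 a m n : 0 <= l2 a m n. Proof. exact: sqrtr_ge0. Qed.

Lemma sum_sqr_ge0 a m n : 0 <= \sum_(m <= k < n) a k ^+ 2.
Proof. by apply: sumr_ge0 => k _; exact: sqr_ge0. Qed.

Lemma l2_sqr a m n : l2 a m n ^+ 2 = \sum_(m <= k < n) a k ^+ 2.
Proof. by rewrite sqr_sqrtr// sum_sqr_ge0. Qed.

Lemma l2_recr a m n : (m <= n)%N -> l2 a m n.+1 = Num.sqrt (l2 a m n ^+ 2 + a n ^+ 2).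
Proof. by move=> mn; rewrite l2_sqr /l2 big_nat_recr. Qed.

Lemma minkowski2 (x y u v : R) :
  Num.sqrt ((x + y) ^+ 2 + (u + v) ^+ 2) <=
  Num.sqrt (x ^+ 2 + u ^+ 2) + Num.sqrt (y ^+ 2 + v ^+ 2).
Proof.
have s1 : 0 <= x ^+ 2 + u ^+ 2 by rewrite addr_ge0 ?sqr_ge0.
have s2 : 0 <= y ^+ 2 + v ^+ 2 by rewrite addr_ge0 ?sqr_ge0.
rewrite -[leRHS]ger0_norm ?addr_ge0 ?sqrtr_ge0// -sqrtr_sqr ler_wsqrtr//.
rewrite [leRHS]sqrrD !sqr_sqrtr// -sqrtrM//.
have : x * y + u * v <= Num.sqrt ((x ^+ 2 + u ^+ 2) * (y ^+ 2 + v ^+ 2)).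
  apply: le_trans (ler_norm _) _; rewrite -sqrtr_sqr ler_wsqrtr//.
  have := sqr_ge0 (x * v - u * y); nra.
rewrite !sqrrD; lra.
Qed.

Lemma l2_triangle a b c m n : (m <= n)%N -> (forall k, 0 <= c k <= a k + b k) ->
  l2 c m n <= l2 a m n + l2 b m n.
Proof.
move=> /subnKC <- cab; elim: (n - m)%N => [|k IH].
  by rewrite addn0 /l2 !big_geq// sqrtr0 addr0.
rewrite addnS !l2_recr ?leq_addr//; apply: le_trans (minkowski2 _ _ _ _).
have /andP[c0 ck] := cab (m + k)%N.
rewrite ler_wsqrtr// lerD//; first by rewrite ler_sqr// nnegrE ?addr_ge0 ?l2_ge0.
by rewrite ler_sqr// nnegrE (le_trans c0 ck).
Qed.

Lemma l2_scale (t : R) a m n : l2 (fun k => t * a k) m n = `|t| * l2 a m n.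
Proof.
rewrite /l2; under eq_bigr do rewrite exprMn.
by rewrite -mulr_sumr sqrtrM ?sqr_ge0// sqrtr_sqr.
Qed.

Lemma l2_le a b m n : (forall k, 0 <= a k <= b k) -> l2 a m n <= l2 b m n.
Proof.
move=> ab; rewrite ler_wsqrtr//; apply: ler_sum => k _.
by have /andP[a0 akb] := ab k; rewrite ler_sqr// nnegrE// (le_trans a0).
Qed.

Lemma l2_cat a m n p : (m <= n)%N -> (n <= p)%N ->
  l2 a m p ^+ 2 = l2 a m n ^+ 2 + l2 a n p ^+ 2.
Proof. by move=> mn np; rewrite !l2_sqr (big_cat_nat mn np). Qed.

Lemma l2_ge a m n k : (m <= k < n)%N -> 0 <= a k -> a k <= l2 a m n.
Proof.
move=> /andP[mk kn] a0; rewrite -[a k]ger0_norm// -sqrtr_sqr ler_wsqrtr//.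
rewrite (big_cat_nat mk (ltnW kn))/= [X in _ + X]big_ltn//.
by rewrite addrCA lerDl addr_ge0 ?sum_sqr_ge0.
Qed.

End L2.

(* Up to a factor 2, the Minkowski functional of [a^-1 W + b^-1 B_X],
   for [W] absolutely convex. *)
Definition interpolation {R : realType} {X : normedModType R} (W : set X) (a b : R) (x : X) : R :=
  inf [set r | exists s w, [/\ 0 <= s, W w & r = a * s + b * `|x - s *: w|]].

Section Interpolation.
Context {R : realType} {X : normedModType R} (W : set X) (a b M : R).
Hypothesis W0 : W 0.
Hypothesis Wac : forall (s t : R) x y, `|s| + `|t| <= 1 -> W x -> W y -> W (s *: x + t *: y).
Hypothesis WM : forall x, W x -> `|x| <= M.
Hypothesis a0 : 0 < a.
Hypothesis b0 : 0 < b.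

Local Notation p := (interpolation W a b).

Let rhs x : set R := [set r | exists s w, [/\ 0 <= s, W w & r = a * s + b * `|x - s *: w|]].

Let rhs_has_inf x : has_inf (rhs x).
Proof.
split; first by eexists; exists 0, 0; split=> //.
by exists 0 => _ [s [w [s0 _ ->]]]; rewrite addr_ge0// mulr_ge0// ltW.
Qed.

Lemma interpolation_le x s w : 0 <= s -> W w -> p x <= a * s + b * `|x - s *: w|.
Proof.
by move=> s0 Ww; apply: ge_inf; [exact: (rhs_has_inf x).2|exists s, w].
Qed.

Lemma interpolation_ge x r :
  (forall s w, 0 <= s -> W w -> r <= a * s + b * `|x - s *: w|) -> r <= p x.
Proof.
move=> rP; apply: lb_le_inf; first exact: (rhs_has_inf x).1.
by move=> _ [s [w [s0 Ww ->]]]; exact: rP.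
Qed.

Lemma interpolation_lt x r : p x < r ->
  exists s w, [/\ 0 <= s, W w & a * s + b * `|x - s *: w| < r].
Proof.
move=> pr; apply: contrapT => nsw; move: pr; apply/negP; rewrite -leNgt.
apply: interpolation_ge => s w s0 Ww; rewrite leNgt; apply/negP => h.
by apply: nsw; exists s, w.
Qed.

Lemma interpolation_seminorm : seminorm p.
Proof.
have pZ t x : p (t *: x) <= `|t| * p x.
  have [->|t0] := eqVneq t 0.
    rewrite scale0r normr0 mul0r; apply: le_trans (interpolation_le _ (lexx 0) W0) _.
    by rewrite mulr0 add0r scale0r subr0 normr0 mulr0.
  have nt : 0 < `|t| by rewrite normr_gt0.
  rewrite -ler_pdivrMl//; apply: interpolation_ge => s w s0 Ww; rewrite ler_pdivrMl//.
  have Ww' : W ((t / `|t|) *: w).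
    rewrite -[_ *: w]addr0 -(scale0r 0); apply: Wac => //.
    by rewrite normr0 addr0 normrM normfV normr_id divff// gt_eqF.
  apply: le_trans (interpolation_le (t *: x) (mulr_ge0 (ltW nt) s0) Ww') _.
  have -> : (`|t| * s) *: ((t / `|t|) *: w) = t *: (s *: w).
    by rewrite !scalerA; congr (_ *: _); field; rewrite gt_eqF.
  by rewrite -scalerBr normrZ le_eqVlt; apply/orP; left; apply/eqP; ring.
split=> [x y|t x].
  rewrite -lerBlDr; apply: interpolation_ge => s w s0 Ww.
  rewrite lerBlDr -lerBlDl; apply: interpolation_ge => s' w' s'0 Ww'.
  rewrite lerBlDl; have [ss0|ss0] := eqVneq (s + s') 0.
    have -> : s = 0 by lra.
    have -> : s' = 0 by lra.
    apply: le_trans (interpolation_le _ (lexx 0) W0) _; rewrite !scale0r !subr0 !mulr0 !add0r.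
    by rewrite -mulrDr ler_pM2l// ler_normD.
  have ss : 0 < s + s' by rewrite lt_neqAle eq_sym ss0 addr_ge0.
  have Wv : W ((s / (s + s')) *: w + (s' / (s + s')) *: w').
    apply: Wac => //; rewrite (ger0_norm (divr_ge0 s0 (ltW ss))).
    by rewrite (ger0_norm (divr_ge0 s'0 (ltW ss))) -mulrDl divff.
  apply: le_trans (interpolation_le (x + y) (ltW ss) Wv) _.
  rewrite scalerDr !scalerA ![(s + s') * (_ / _)]mulrC !divfK// opprD addrACA.
  have := ler_wpM2l (ltW b0) (ler_normD (x - s *: w) (y - s' *: w')).
  by rewrite !mulrDr; lra.
apply/le_anti; rewrite pZ/=; have [->|t0] := eqVneq t 0.
  rewrite normr0 mul0r; apply: interpolation_ge => s w s_ge0 _.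
  by rewrite addr_ge0// mulr_ge0// ltW.
rewrite -ler_pdivlMl ?normr_gt0// -normfV.
by apply: le_trans (pZ _ _); rewrite scalerA mulVf// scale1r.
Qed.

Lemma interpolation_le_norm x : p x <= b * `|x|.
Proof.
apply: le_trans (interpolation_le x (lexx 0) W0) _.
by rewrite mulr0 add0r scale0r subr0.
Qed.

Lemma interpolation_set x : W x -> p x <= a.
Proof.
move=> Wx; apply: le_trans (interpolation_le x ler01 Wx) _.
by rewrite scale1r subrr normr0 mulr0 addr0 mulr1.
Qed.

Lemma norm_le_interpolation x : `|x| <= (M / a + b^-1) * p x.
Proof.
have M0 : 0 <= M by apply: le_trans (WM W0).
have c0 : 0 < M / a + b^-1 by rewrite ltr_wpDl ?invr_gt0// divr_ge0// ltW.
rewrite -ler_pdivrMl//; apply: interpolation_ge => s w s0 Ww; rewrite ler_pdivrMl//.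
rewrite -[x in leLHS](subrK (s *: w)); apply: le_trans (ler_normD _ _) _.
rewrite normrZ (ger0_norm s0).
have h1 := ler_wpM2l s0 (WM Ww).
set d := `|x - s *: w|; have d0 : 0 <= d by exact: normr_ge0.
have a_ge0 := ltW a0; have b_ge0 := ltW b0.
have h2 : 0 <= M / a * b * d by rewrite !mulr_ge0 ?invr_ge0.
have h3 : 0 <= b^-1 * a * s by rewrite !mulr_ge0 ?invr_ge0.
have -> : (M / a + b^-1) * (a * s + b * d) = s * M + d + M / a * b * d + b^-1 * a * s.
  by field; rewrite !gt_eqF.
lra.
Qed.

End Interpolation.

(** An l2-sum of seminorms is given by its partial sums, whose supremum is to be the norm: no series
    occurs, and estimates pass to limits one partial sum at a time. *)
Record norm_sequence {R : realType} (X : normedModType R) := NormSequence {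
  ns_fun :> nat -> X -> R;
  ns_seminorm : forall n, seminorm (ns_fun n);
  ns_continuous : forall n, exists2 C, 0 <= C & forall x, ns_fun n x <= C * `|x|;
  ns_dominates : exists2 C, 0 < C & forall x, `|x| <= C * ns_fun 0%N x }.

Section SupSpace.
Context {R : realType} {X : normedModType R} (N : norm_sequence X).

Definition sup_pred : {pred X} := fun x => `[< exists M, forall n, N n x <= M >].

Lemma sup_pred_subsemimod : GRing.subsemimod_closed sup_pred.
Proof.
split; [split|].
- apply/asboolP; exists 0 => n; by rewrite seminorm0//; exact: ns_seminorm.
- move=> x y /asboolP[M xM] /asboolP[L yL]; apply/asboolP; exists (M + L) => n.
  by apply: le_trans ((ns_seminorm N n).1 x y) _; exact: lerD.
- move=> a x /asboolP[M xM]; apply/asboolP; exists (`|a| * M) => n.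
  by rewrite (ns_seminorm N n).2 ler_wpM2l.
Qed.

Lemma sup_pred_oppr : oppr_closed sup_pred.
Proof. by move=> x Nx; rewrite -scaleN1r; exact: (sup_pred_subsemimod).2. Qed.

HB.instance Definition _ := GRing.isAddClosed.Build X
  sup_pred sup_pred_subsemimod.1.
HB.instance Definition _ := GRing.isOppClosed.Build X
  sup_pred sup_pred_oppr.
HB.instance Definition _ := GRing.isScaleClosed.Build R X
  sup_pred sup_pred_subsemimod.2.

Record sup_space := SupSpace { sup_val : X ; _ : sup_val \in sup_pred }.

HB.instance Definition _ := [isSub for sup_val].
HB.instance Definition _ := [Choice of sup_space by <:].
HB.instance Definition _ := [SubChoice_isSubLmodule of sup_space by <:].

Implicit Types x y : sup_space.

Definition sup_space_norm x : R := sup (range (fun n => N n (sup_val x))).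

Lemma sup_val_linear : linear sup_val.
Proof. by []. Qed.

Lemma sup_space_has_sup x : has_sup (range (fun n => N n (sup_val x))).
Proof.
split; first by exists (N 0%N (sup_val x)), 0%N.
by case: x => x /= /asboolP[M xM]; exists M => _ [n _ <-].
Qed.

Lemma sup_space_ub x n : N n (sup_val x) <= sup_space_norm x.
Proof. by apply: sup_upper_bound; [exact: sup_space_has_sup|exists n]. Qed.

Lemma sup_space_lub x M : (forall n, N n (sup_val x) <= M) -> sup_space_norm x <= M.
Proof.
by move=> xM; apply: ge_sup; [exact: (sup_space_has_sup x).1|move=> _ [n _ <-]].
Qed.

Lemma sup_space_triangle x y :
  sup_space_norm (x + y) <= sup_space_norm x + sup_space_norm y.
Proof.
apply: sup_space_lub => n; apply: le_trans ((ns_seminorm N n).1 _ _) _.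
by apply: lerD; exact: sup_space_ub.
Qed.

Lemma sup_space_normZ_le a x : sup_space_norm (a *: x) <= `|a| * sup_space_norm x.
Proof.
apply: sup_space_lub => n; rewrite [N n _](ns_seminorm N n).2.
by rewrite ler_wpM2l// sup_space_ub.
Qed.

Lemma sup_space_norm_ge0 x : 0 <= sup_space_norm x.
Proof. exact: le_trans (seminorm_ge0 (ns_seminorm N 0) _) (sup_space_ub x 0). Qed.

Lemma sup_space_normZ a x : sup_space_norm (a *: x) = `|a| * sup_space_norm x.
Proof.
apply/le_anti/andP; split; first exact: sup_space_normZ_le.
have [->|a0] := eqVneq a 0; first by rewrite normr0 mul0r sup_space_norm_ge0.
rewrite -ler_pdivlMl ?normr_gt0// -normfV.
by rewrite -{1}[x](scalerK a0) sup_space_normZ_le.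
Qed.

Lemma sup_space_norm_eq0 x : sup_space_norm x = 0 -> x = 0.
Proof.
move=> x0; apply/val_inj/eqP; rewrite -normr_le0.
have [C C0 xC] := ns_dominates N; apply: le_trans (xC _) _.
by rewrite pmulr_rle0// -x0; exact: sup_space_ub.
Qed.

HB.instance Definition _ := Lmodule_isNormed.Build R sup_space
  sup_space_triangle sup_space_normZ sup_space_norm_eq0.

Lemma sup_space_le x n : N n (sup_val x) <= `|x|.
Proof. exact: sup_space_ub. Qed.

Lemma sup_space_norm_le x M : (forall n, N n (sup_val x) <= M) -> `|x| <= M.
Proof. exact: sup_space_lub. Qed.

Lemma sup_space_ex (x : X) M : (forall n, N n x <= M) ->
  exists2 z : sup_space, sup_val z = x & `|z| <= M.
Proof.
move=> xM; have Nx : x \in sup_pred by apply/asboolP; exists M.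
by exists (SupSpace Nx) => //; exact: sup_space_norm_le.
Qed.

Lemma sup_val_bound : exists2 C, 0 < C & forall z : sup_space, `|sup_val z| <= C * `|z|.
Proof.
have [C C0 xC] := ns_dominates N; exists C => // z.
by apply: le_trans (xC _) _; rewrite ler_pM2l// sup_space_le.
Qed.

Lemma sup_val_continuous : continuous sup_val.
Proof.
have [C _ zC] := sup_val_bound.
exact: (bound_continuous sup_val_linear zC).
Qed.

Definition sup_embedding : bounded_operator sup_space X :=
  mk_bounded_operator sup_val_linear sup_val_continuous.

(** The limit is taken in [X], after division by [C] to restore the required gaps. Each [N k] is
    continuous on [X] and so inherits the tail estimate, with a bound independent of [k]. *)
Lemma rapid_complete_sup_space : rapid_complete X -> rapid_complete sup_space.
Proof.
move=> cX u uh; have [C C0 zC] := sup_val_bound.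
have [|y yu] := cX (fun n => C^-1 *: sup_val (u n)).
  move=> n; rewrite -scalerBr normrZ gtr0_norm ?invr_gt0// ler_pdivrMl//.
  by apply: le_trans (zC (u n.+1 - u n)) _; rewrite ler_pM2l.
have Ny k n : N k (C *: y - sup_val (u n)) <= 2 * 2^-1 ^+ n.
  have [D D0 ND] := ns_continuous N k.
  apply/ler_addgt0Pl => e e0.
  have c0 : 0 < 2 * (C * (D + 1)) by rewrite !mulr_gt0// ltr_wpDl.
  have [m me] := half_expn_small (divr_gt0 e0 c0); rewrite ltr_pdivlMr// in me.
  pose l := maxn n m.
  have -> : C *: y - sup_val (u n) =
      (C *: y - sup_val (u l)) + (sup_val (u l) - sup_val (u n)) by rewrite addrA subrK.
  apply: le_trans ((ns_seminorm N k).1 _ _) _; apply: lerD; last first.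
    apply: le_trans (sup_space_le (u l - u n) k) _.
    by apply: rapid_tail => //; exact: leq_maxl.
  apply: le_trans (ND _) (le_trans _ (ltW me)).
  have -> : C *: y - sup_val (u l) = C *: (y - C^-1 *: sup_val (u l)).
    by rewrite scalerBr scalerA divff ?scale1r// gt_eqF.
  rewrite normrZ (gtr0_norm C0).
  have h1 := yu l.
  have h2 : 2^-1 ^+ l <= 2^-1 ^+ m :> R.
    by rewrite ler_wiXn2l ?invr_ge0// ?invf_le1 ?ler1n// leq_maxr.
  have h3 : D * (C * `|y - C^-1 *: sup_val (u l)|) <= D * (C * (2 * 2^-1 ^+ m)).
    apply: ler_wpM2l => //; apply: ler_wpM2l; first exact: ltW.
    by apply: le_trans h1 _; rewrite ler_wpM2l.
  apply: le_trans h3 _.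
  have q0 : 0 <= 2^-1 ^+ m :> R by rewrite exprn_ge0// invr_ge0.
  have := mulr_ge0 (ltW C0) q0; nra.
have [|z zy _] := @sup_space_ex (C *: y) (2 * 2^-1 ^+ 0 + `|u 0%N|).
  move=> k; rewrite -[C *: y](subrK (sup_val (u 0%N))).
  apply: le_trans ((ns_seminorm N k).1 _ _) _; apply: lerD; first exact: Ny.
  exact: sup_space_le.
exists z => n; apply: sup_space_norm_le => k.
by apply: le_trans (Ny k n); rewrite -zy.
Qed.

End SupSpace.

(** * Reflexivity by factorization *)

Section Goldstine.
Context {R : realType} {Z : normedModType R} (Phi : dual (dual Z)).

(** Otherwise a linear form separates the vectors [f i z - Phi (f i)] from 0. Its weights combine
    the [f i] into a [g] with [g z - Phi g >= e] on the ball of radius [|Phi|], whence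
    [|g| |Phi| <= - Phi g - e], which is absurd. *)
Lemma goldstine (k : nat) (f : nat -> dual Z) (e : R) : 0 < e ->
  exists2 z : Z, `|z| <= `|Phi| & forall i, (i < k)%N -> `|f i z - Phi (f i)| < e.
Proof.
move=> e0; pose E : lmodType R := (nat -> R^o)%type.
pose p (v : E) : R := \sum_(i < k) `|v i|.
have sp : sublinear p.
  split=> [u v|t v t0].
    by rewrite /p -big_split/=; apply: ler_sum => i _; exact: ler_normD.
  rewrite /p mulr_sumr; apply: eq_bigr => i _.
  by rewrite -[(t *: v) i]/(t * v i) normrM ger0_norm.
pose d z : E := fun i => f i z - Phi (f i).
pose D : set E := [set d z | z in [set z : Z | `|z| <= `|Phi|]].
have [[z zP zD]|nz] := pselect (exists2 z : Z, `|z| <= `|Phi| & p (d z) < e).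
  exists z => // i ik; apply: le_lt_trans zD.
  rewrite /p (bigD1 (Ordinal ik))//= lerDl; exact: sumr_ge0.
exfalso; have [|||h [lh hp hD]] := @mazur_orlicz_convex R E p D e sp.
- by exists (d 0), 0 => //=; rewrite normr0.
- move=> t _ _ /andP[t0 t1] [x xP <-] [y yP <-]; exists (t *: x + (1 - t) *: y).
    rewrite /=; apply: le_trans (ler_normD _ _) _; rewrite !normrZ.
    have t1' : 0 <= 1 - t by rewrite subr_ge0.
    rewrite (ger0_norm t0) (ger0_norm t1').
    have := ler_wpM2l t0 xP; have := ler_wpM2l t1' yP; lra.
  apply/funext => i; rewrite /d dualD !dualZ.
  change (t * f i x + (1 - t) * f i y - Phi (f i) =
    t * (f i x - Phi (f i)) + (1 - t) * (f i y - Phi (f i))); ring.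
- move=> _ [z zP <-]; rewrite leNgt; apply/negP => h; apply: nz; by exists z.
pose delta (j : nat) : E := fun i => (i == j)%:R.
pose w (j : nat) : R := h (delta j).
(* [E] stands for [R^k]: since [h <= p] and [p] does not see coordinates from [k] on, neither does
   [h]. *)
have hE v : h v = \sum_(i < k) v i * w i.
  pose v' : E := \sum_(j < k) v j *: delta j.
  have v'E i : (i < k)%N -> v' i = v i.
    move=> ik; rewrite /v' fct_sumE (bigD1 (Ordinal ik))//= big1 => [|j].
      by rewrite addr0; change (v i * (i == i)%:R = v i); rewrite eqxx mulr1.
    rewrite -val_eqE/= eq_sym => /negPf ji.
    by change (v j * (i == j)%:R = 0); rewrite ji mulr0.
  have p0 : p (v - v') = 0.
    rewrite /p big1// => i _; rewrite -[(v - v') i]/(v i - v' i) v'E//.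
    by rewrite subrr normr0.
  have p0' : p (v' - v) = 0.
    rewrite /p big1// => i _; rewrite -[(v' - v) i]/(v' i - v i) v'E//.
    by rewrite subrr normr0.
  have -> : h v = h v'.
    have := hp (v - v'); have := hp (v' - v); rewrite p0 p0' !lh.1.
    rewrite !(linear_formN _ lh); lra.
  rewrite /v'; elim: (k) => [|m IH]; first by rewrite !big_ord0 linear_form0.
  by rewrite !big_ord_recr/= lh.1 lh.2 IH.
pose g : dual Z := \sum_(i < k) w i *: f i.
have gz z : g z = \sum_(i < k) w i * f i z by exact: dual_sumE.
have gP : Phi g = \sum_(i < k) w i * Phi (f i).
  by rewrite /g; exact: (linear_form_sum k w f (dual_linear_form Phi)).
have gap z : `|z| <= `|Phi| -> e <= g z - Phi g.
  move=> zP; have -> : g z - Phi g = h (d z).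
    rewrite hE gz gP -sumrB; apply: eq_bigr => i _; rewrite /d; ring.
  by apply: hD; exists z.
have : `|g| * `|Phi| <= - Phi g - e.
  have [P0|P0] := eqVneq `|Phi| 0.
    rewrite P0 mulr0; have := gap 0; rewrite normr0 linear0.
    by move=> /(_ (normr_ge0 _)); lra.
  have P0' : 0 < `|Phi| by rewrite lt_neqAle eq_sym P0 normr_ge0.
  rewrite -ler_pdivlMr//; apply: operator_norm_lub => z z1.
  rewrite ler_pdivlMr// mulrC -[`|Phi|]normr_id -normrM -dualZ.
  have zP : `| `|Phi| *: z| <= `|Phi| by rewrite normrZ normr_id ler_piMr.
  have := gap (- (`|Phi| *: z)); have := gap (`|Phi| *: z); rewrite normrN => /(_ zP) h1.
  move=> /(_ zP); rewrite dualN => h2; rewrite ler_norml; apply/andP; split; lra.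
have := dual_le Phi g; rewrite ler_norml => /andP[h1 _]; rewrite mulrC; lra.
Qed.

Lemma goldstine_ultrafilter : exists G : set_system Z,
  [/\ UltraFilter G, \forall z \near G, `|z| <= `|Phi| &
      forall f : dual Z, f @ G --> Phi f].
Proof.
pose B (se : seq (dual Z) * R) : set Z :=
  [set z | `|z| <= `|Phi| /\ forall f, f \in se.1 -> `|f z - Phi f| < se.2].
pose F := filter_from [set se : seq (dual Z) * R | 0 < se.2] B.
have FF : ProperFilter F.
  apply: filter_from_proper; last first.
    move=> [s e] /= e0.
    have [z zP zs] := goldstine (size s) (nth 0 s) e0.
    exists z; split=> // f /= fs; have := zs (index f s).
    by rewrite index_mem nth_index//; exact.
  apply: filter_from_filter; first by exists ([::], 1) => /=; exact: ltr01.
  move=> [s e] [s' e'] /= e0 e'0; exists (s ++ s', Num.min e e').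
    by rewrite /= lt_min e0.
  move=> z [zP zs]; split; split=> // f /= fs.
    by have := zs f; rewrite /= mem_cat fs => /(_ isT); rewrite lt_min => /andP[].
  by have := zs f; rewrite /= mem_cat fs orbT => /(_ isT); rewrite lt_min => /andP[].
have [G [GU FG]] := ultraFilterLemma FF; exists G; split=> //.
  apply: FG; exists ([::], 1); first exact: ltr01.
  by move=> z [].
move=> f; apply/cvgrPdistC_lt => e e0; apply: FG; exists ([:: f], e) => //.
by move=> z [_ /(_ f)]; rewrite /= mem_head; exact.
Qed.

End Goldstine.

Section Factorization.
Context {R : realType} {Z X : normedModType R} (T : bounded_operator Z X).

(** Mazur-Orlicz on [X] gives [g] with [f z - e |z| <= g (T z)]; the same inequality at [- z] bounds
    the other side. *)
Lemma dual_approx (f : dual Z) (M e : R) : 0 <= M -> 0 <= e ->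
  (forall z, f z <= M * `|T z| + e * `|z|) ->
  exists g : dual X, forall z, `|f z - g (T z)| <= e * `|z|.
Proof.
move=> M0 e0 fM.
pose G (d : X) (c : R) := exists2 z, d = T z & c <= f z - e * `|z|.
have [||||h [lh hle hG]] := @mazur_orlicz R X _ G (sublinear_norm M0).
- by exists 0; rewrite ?linear0// normr0 mulr0 subr0.
- move=> d c d' c' [z -> zc] [z' -> zc']; exists (z + z'); first by rewrite linearD.
  rewrite dualD; have := ler_wpM2l e0 (ler_normD z z'); rewrite mulrDr; lra.
- move=> t d c t0 [z -> zc]; exists (t *: z); first by rewrite linearZ.
  rewrite dualZ normrZ (ger0_norm t0) mulrCA -mulrBr; exact: ler_wpM2l.
- by move=> d c [z -> zc]; have := fM z; lra.
have [g [gh _]] := linear_form_dual lh M0 hle.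
exists g => z; have le1 y : f y - e * `|y| <= g (T y) by rewrite gh; apply: hG; exists y.
have := le1 z; have := le1 (- z); rewrite dualN normrN linearN dualN ler_norml.
by move=> h1 h2; apply/andP; split; lra.
Qed.

Lemma sqrt_one_le (a b : R) : 0 <= a ->
  Num.sqrt ((1 + a) ^+ 2 + b ^+ 2) <= 1 + a + b ^+ 2 / 2.
Proof.
move=> a0; have b0 := sqr_ge0 b.
have s0 : 0 <= 1 + a + b ^+ 2 / 2 by lra.
rewrite -[leRHS]ger0_norm// -sqrtr_sqr ler_wsqrtr//; nra.
Qed.

(* Asymptotic smoothness of the norm of [Z] in the directions where [T] is small
   forces [f] to be small where [T] is small, hence [T^* X^*] dense in [Z^*]. *)
Lemma smooth_functional_bound (f : dual Z) (e : R) : 0 < e ->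
  (forall S tau, `|S| <= 1 -> 0 < tau -> exists2 C, 0 <= C &
     forall z, `|S + z| ^+ 2 <= (1 + C * `|T z|) ^+ 2 + (tau + `|z|) ^+ 2) ->
  exists2 M, 0 <= M & forall z, f z <= M * `|T z| + e * `|z|.
Proof.
(* [f] is tested at [S + t z] with [S] nearly norming. The deficit [t e / 2] at [S] and the second
   order term [2 |f| t^2], at most [t e / 2] by the choice of [t], add up to [t e]; division by [t]
   leaves [e]. *)
move=> e0 smooth; pose t := e / (4 * (`|f| + 1)).
have L0 := normr_ge0 f; set L := `|f| in t L0 *.
have L1 : 0 < 4 * (L + 1) by rewrite mulr_gt0// ltr_wpDl.
have t0 : 0 < t by rewrite divr_gt0.
have tL : t * (4 * (L + 1)) = e by rewrite /t divfK// gt_eqF.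
have [S [S1 fS]] : exists S, `|S| <= 1 /\ L - t * e / 2 <= f S.
  have et : 0 < t * e / 2 by rewrite divr_gt0// mulr_gt0.
  have [_ [S S1 <-] LS] := sup_adherent et (operator_norm_has_sup f).
  have [fS|fS] := leP 0 (f S).
    by exists S; split=> //; apply: ltW; rewrite -[f S]ger0_norm.
  exists (- S); split; first by rewrite normrN.
  by apply: ltW; rewrite dualN -[- f S]ger0_norm ?oppr_ge0 ?ltW// normrN.
have [C C0 SC] := smooth S t S1 t0.
have bound z : `|z| <= 1 -> f z <= L * C * `|T z| + e.
  move=> z1; have tz1 : `|t *: z| <= t by rewrite normrZ gtr0_norm// ler_piMr// ltW.
  have a0 : 0 <= C * `|T (t *: z)| by rewrite mulr_ge0.
  have : `|S + t *: z| <= 1 + C * `|T (t *: z)| + (2 * t) ^+ 2 / 2.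
    apply: le_trans (sqrt_one_le _ a0).
    rewrite -[leLHS]normr_id -sqrtr_sqr ler_wsqrtr//; apply: le_trans (SC _) _.
    rewrite lerD2l ler_sqr ?nnegrE; first by lra.
      by rewrite addr_ge0// ltW.
    by rewrite mulr_ge0// ltW.
  rewrite linearZ normrZ (gtr0_norm t0) => h.
  have := le_trans (ler_norm _) (dual_le f (S + t *: z)); rewrite dualD dualZ.
  have := ler_wpM2l L0 h; rewrite -/L => h1 h2.
  rewrite -(ler_pM2l t0).
  set q := `|T z| in h1 *; set u := f z in h2 *.
  have h3 : L * (t * t) <= t * e / 4.
    rewrite -[X in t * X / 4]tL; have := mulr_gt0 t0 t0; nra.
  move: h1 h2 h3 fS; set fs := f S; set nz := `|S + _|.
  nra.
exists (L * C); first exact: mulr_ge0.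
move=> z; have [->|z0] := eqVneq z 0.
  by rewrite !linear0 !normr0 !mulr0 addr0.
have nz : 0 < `|z| by rewrite normr_gt0.
have := bound (`|z|^-1 *: z); rewrite normrZ normfV normr_id mulVf ?gt_eqF//.
move=> /(_ (lexx _)); rewrite dualZ linearZ normrZ normfV normr_id.
rewrite ler_pdivrMl// => h; apply: le_trans h _.
by rewrite le_eqVlt; apply/orP; left; apply/eqP; field; rewrite gt_eqF.
Qed.

(** Goldstine's theorem represents [Phi] by an ultrafilter on a ball of [Z], whose image has a weak
    limit [x = T z0]. So [Phi] and the evaluation at [z0] agree on the functionals [g \o T], and
    these are dense in the dual of [Z]. *)
Theorem reflexive_by_factorization :
  (forall r, relatively_weakly_compact (T @` [set z | `|z| <= r])) ->
  (forall (f : dual Z) e, 0 < e ->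
    exists2 M, 0 <= M & forall z, f z <= M * `|T z| + e * `|z|) ->
  (forall (G : set_system Z) r x, UltraFilter G -> (\forall z \near G, `|z| <= r) ->
    (forall g : dual X, (fun z => g (T z)) @ G --> g x) -> exists z, T z = x) ->
  reflexive_space Z.
Proof.
move=> Tc fT Tclosed; apply/seteqP; split=> // Phi _.
have [G [GU GP Gf]] := goldstine_ultrafilter Phi.
have Gr : \forall z \near G, (T @` [set z | `|z| <= `|Phi|]) (T z).
  by apply: filterS GP => z zP; exists z.
have [x Gx] := rel_weakly_compact_limit_near (Tc `|Phi|) GU Gr.
have [z0 z0x] := Tclosed G `|Phi| x GU GP Gx.
exists z0 => //; apply/val_inj/funext => f; apply/eqP; rewrite -subr_eq0 -normr_le0.
change (`|f z0 - Phi f| <= 0); apply/ler_addgt0Pl => e e0; rewrite addr0.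
have c0 : 0 < `|z0| + `|Phi| + 1 by rewrite ltr_wpDl// addr_ge0.
pose d := e / (`|z0| + `|Phi| + 1); have d0 : 0 < d by rewrite divr_gt0.
have [M M0 fM] := fT f d d0.
have [g gP] := dual_approx M0 (ltW d0) fM.
have Pg : `|Phi f - g x| <= d * `|Phi|.
  apply: ultra_cvg_le (cvg_norm (cvgB (Gf f) (Gx g))) _.
  apply: filterS GP => z zP; apply: le_trans (gP z) _.
  by rewrite ler_wpM2l// ltW.
have := gP z0; rewrite z0x => zg.
have -> : f z0 - Phi f = (f z0 - g x) - (Phi f - g x) by ring.
apply: le_trans (ler_normB _ _) _; apply: le_trans (lerD zg Pg) _.
by rewrite -mulrDr /d mulrAC ler_pdivrMr// ler_wpM2l ?(ltW e0)// lerDl.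
Qed.

End Factorization.

(** * The factorization theorem *)

(** Replacing each point by [s w] costs [e / 4] on either side of a cut; the remaining gap [e / 2]
    is divided by [s]. *)
Lemma pattern_approx {R : realType} {X : normedModType R} (A W : set X) (n : nat) (e s : R) :
  0 < s -> (forall a, A a -> exists2 w, W w & `|a - s *: w| <= e / 4) ->
  pattern A n e -> pattern W n (e / (2 * s)).
Proof.
move=> s0 AW [y [f [Ay f1 fy]]].
have /choice[w wP] j : exists w, W w /\ `|y j - s *: w| <= e / 4.
  by have [w Ww h] := AW _ (Ay j); exists w.
exists w, f; split=> //; first by move=> j; exact: (wP j).1.
move=> i j k ki ij jn; rewrite -(ler_pM2l s0) mulrDr.
have -> : s * (e / (2 * s)) = e / 2 by field; rewrite gt_eqF.
rewrite -!dualZ.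
have hj := dual_le1 (f1 i) (wP j).2; have hk := dual_le1 (f1 i) (wP k).2.
move: hj hk; rewrite !dualD !dualN !ler_norml => /andP[_ hj] /andP[hk _].
have := fy i j k ki ij jn; lra.
Qed.

(** Some linear form below [p] equals [p] at [x]. It is norm continuous because [p] is, so its bound
    passes to the weak limit. *)
Lemma seminorm_weak_lsc {R : realType} {X : normedModType R} (p : X -> R) (C r : R)
    (T : Type) (V : set_system T) (u : T -> X) (x : X) :
  seminorm p -> 0 <= C -> (forall y, p y <= C * `|y|) -> UltraFilter V ->
  (\forall t \near V, p (u t) <= r) ->
  (forall g : dual X, (fun t => g (u t)) @ V --> g x) -> p x <= r.
Proof.
move=> sp C0 pC VU pu ux.
pose G d c := exists2 t, 0 <= t & d = t *: x /\ c = t * p x.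
have [||||h [lh hle hG]] := @mazur_orlicz R X _ G (seminorm_sublinear sp).
- by exists 0; rewrite // scale0r mul0r.
- move=> _ _ _ _ [t t0 [-> ->]] [s s0 [-> ->]]; exists (t + s).
    exact: addr_ge0.
  by rewrite scalerDl mulrDl.
- move=> t _ _ t0 [s s0 [-> ->]]; exists (t * s); first exact: mulr_ge0.
  by rewrite scalerA mulrA.
- by move=> _ _ [t t0 [-> ->]]; rewrite sp.2 ger0_norm.
have [g [gh _]] := linear_form_dual lh C0 (fun y => le_trans (hle y) (pC y)).
apply: (@le_trans _ _ (g x)).
  by rewrite gh; apply: hG; exists 1; rewrite ?scale1r ?mul1r.
apply: ultra_cvg_le (ux g) _; apply: filterS pu => t; apply: le_trans.
by rewrite gh; exact: hle.
Qed.

(** * The interpolation space of a bounded absolutely convex set *)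

Section InterpolationSpace.
Context {R : realType} {X : normedModType R} (W : set X) (M : R).
Hypothesis W0 : W 0.
Hypothesis Wac : forall (s t : R) x y, `|s| + `|t| <= 1 -> W x -> W y -> W (s *: x + t *: y).
Hypothesis WM : forall x, W x -> `|x| <= M.

Let half n : 0 < 2^-1 ^+ n :> R. Proof. by rewrite exprn_gt0// invr_gt0. Qed.
Let two n : 0 < 2 ^+ n :> R. Proof. by rewrite exprn_gt0. Qed.

(** Up to a factor 2, the gauge of [2^(k+1) W + 2^-(k+1) B_X]. Exponents start at 1 to keep the sum
    of the squares of the [2^-(k+1)] below 1, which puts [W] in the unit ball. *)
Let p (k : nat) : X -> R := interpolation W (2^-1 ^+ k.+1) (2 ^+ k.+1).

Let p_seminorm k : seminorm (p k).
Proof. exact: interpolation_seminorm. Qed.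

Let p_ge0 k x : 0 <= p k x.
Proof. exact: seminorm_ge0. Qed.

Let N (n : nat) (x : X) : R := l2 (p ^~ x) 0 n.+1.

Let l2D x y m n : (m <= n)%N -> l2 (p ^~ (x + y)) m n <= l2 (p ^~ x) m n + l2 (p ^~ y) m n.
Proof. by move=> mn; apply: l2_triangle => // k; rewrite p_ge0 (p_seminorm k).1. Qed.

Let N_seminorm n : seminorm (N n).
Proof.
split=> [x y|t x]; first exact: l2D.
rewrite /N -[`|t|]normr_id -l2_scale; congr (l2 _ _ _); apply/funext => k; exact: (p_seminorm k).2.
Qed.

Let N_continuous n : exists2 C, 0 <= C & forall x, N n x <= C * `|x|.
Proof.
exists (l2 (fun k => 2 ^+ k.+1) 0 n.+1); first exact: l2_ge0.
move=> x; rewrite mulrC -[`|x|]normr_id -l2_scale; apply: l2_le => k.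
by rewrite p_ge0/= mulrC; exact: interpolation_le_norm.
Qed.

Let p_le_N k n x : (k <= n)%N -> p k x <= N n x.
Proof. by move=> kn; apply: (@l2_ge _ (p ^~ x)). Qed.

Let N_dominates : exists2 C, 0 < C & forall x, `|x| <= C * N 0%N x.
Proof.
exists (M / 2^-1 ^+ 1 + (2 ^+ 1)^-1).
  by rewrite ltr_wpDl ?invr_gt0// divr_ge0 ?(ltW (half 1))//; apply: le_trans (WM W0).
move=> x; have h := @norm_le_interpolation R X W (2^-1 ^+ 1) (2 ^+ 1) M W0 WM (half 1) (two 1) x.
apply: le_trans h _; rewrite ler_wpM2l ?(@p_le_N 0%N 0%N)//.
by rewrite addr_ge0 ?invr_ge0 ?(ltW (two 1))// divr_ge0 ?(ltW (half 1))//; apply: le_trans (WM W0).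
Qed.

Definition interpolation_norms : norm_sequence X :=
  NormSequence N_seminorm N_continuous N_dominates.

Local Notation Z := (sup_space interpolation_norms).
Local Notation T := (sup_embedding interpolation_norms).

Let sum_half n : \sum_(0 <= k < n) (2^-1 ^+ k.+1) ^+ 2 <= 1 - 2^-1 ^+ n :> R.
Proof.
elim: n => [|n IH]; first by rewrite big_geq// expr0 subrr.
rewrite big_nat_recr//=; apply: le_trans (lerD IH (lexx _)) _.
have h1 : 2^-1 ^+ n <= 1 :> R by rewrite exprn_ile1 ?invr_ge0// invf_le1// ler1n.
have := half n; rewrite (exprS 2^-1 n); set q := 2^-1 ^+ n in h1 *; nra.
Qed.

Lemma interpolation_space_contains : W `<=` T @` unit_ball Z.
Proof.
move=> x Wx; have [|z zx z1] := @sup_space_ex _ _ interpolation_norms x 1; last by exists z.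
move=> n; apply: (@le_trans _ _ (l2 (fun k => 2^-1 ^+ k.+1) 0 n.+1)).
  by apply: l2_le => k; rewrite p_ge0; exact: interpolation_set.
rewrite -[leRHS]sqrtr1 ler_wsqrtr//; apply: le_trans (sum_half _) _.
by have := half n.+1; lra.
Qed.

Lemma interpolation_space_approx (r e : R) : 0 < e -> exists2 s, 0 < s &
  forall z : Z, `|z| <= r -> exists2 w, W w & `|T z - s *: w| <= e.
Proof.
move=> e0; pose r' := `|r| + 1; have r'0 : 0 < r' by rewrite ltr_wpDl.
have [k ke] := half_expn_small (divr_gt0 e0 r'0); rewrite ltr_pdivlMr// in ke.
exists (r' * 2 ^+ k.+1); first exact: mulr_gt0.
move=> z zr; have : p k (T z) < r'.
  apply: (@le_lt_trans _ _ r).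
    by apply: le_trans (p_le_N _ (leqnn k)) (le_trans (sup_space_le z k) zr).
  by rewrite /r'; have := ler_norm r; lra.
move=> /(interpolation_lt W0 (half k.+1) (two k.+1))[s [w [s0 Ww lt_r]]].
have inv2 : 2^-1 ^+ k.+1 * 2 ^+ k.+1 = 1 :> R by rewrite -exprMn mulVf// expr1n.
have d0 : 0 <= `|T z - s *: w| by [].
have sb : s <= r' * 2 ^+ k.+1.
  have h : 2^-1 ^+ k.+1 * s <= r'.
    by apply/ltW/(le_lt_trans _ lt_r); rewrite lerDl mulr_ge0// ltW.
  have := ler_wpM2l (ltW (two k.+1)) h.
  by rewrite mulrA [2 ^+ _ * 2^-1 ^+ _]mulrC inv2 mul1r [_ * r']mulrC.
have db : `|T z - s *: w| <= e.
  apply: le_trans (ltW ke); set d := `|_| in d0 lt_r *.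
  have h1 : 2 ^+ k.+1 * d <= r'.
    by apply: le_trans (ltW lt_r); rewrite lerDr mulr_ge0// ltW.
  have := ler_wpM2l (ltW (half k.+1)) h1; rewrite mulrA inv2 mul1r exprS.
  have := mulr_gt0 (half k) r'0; lra.
exists ((s / (r' * 2 ^+ k.+1)) *: w).
  rewrite -[_ *: w]addr0 -(scale0r 0); apply: Wac => //.
  rewrite normr0 addr0 ger0_norm ?divr_ge0 ?mulr_ge0 ?(ltW r'0) ?(ltW (two k.+1))//.
  by rewrite ler_pdivrMr ?mul1r// mulr_gt0.
by rewrite scalerA mulrCA divff ?mulr1// gt_eqF// mulr_gt0.
Qed.

(** The l2-sum is cut at an index [m] that carries nearly all of [|S|]. Up to the cut, finitely many
    gauges bound [z] by [C |T z|]; beyond it, [S] contributes at most [tau]. The squares of the two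
    segments add up. *)
Lemma interpolation_space_smooth (S : Z) (tau : R) : `|S| <= 1 -> 0 < tau ->
  exists2 C, 0 <= C &
    forall z, `|S + z| ^+ 2 <= (1 + C * `|T z|) ^+ 2 + (tau + `|z|) ^+ 2.
Proof.
(* As [|S| <= 1], a deficit below [tau^2 / 2] in the norm leaves at most [tau^2] for the square of
   the tail. *)
move=> S1 tau0; have t2 : 0 < tau ^+ 2 / 2 by rewrite divr_gt0// exprn_gt0.
have [_ [m _ <-] Sm] := sup_adherent t2 (sup_space_has_sup S).
rewrite -[sup _]/(`|S|) -[interpolation_norms m _]/(N m (T S)) in Sm.
have [C C0 NC] := N_continuous m; exists C => // z.
set rhs := (X in _ <= X); have rhs0 : 0 <= rhs by rewrite addr_ge0// sqr_ge0.
rewrite -[rhs]sqr_sqrtr// ler_sqr ?nnegrE ?sqrtr_ge0//.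
apply: sup_space_norm_le => n; pose q := maxn m n.
apply: (@le_trans _ _ (N q (T S + T z))).
  have -> : sup_val (S + z) = T S + T z by [].
  rewrite /interpolation_norms/= /N ler_wsqrtr//.
  rewrite (big_cat_nat (leq0n n.+1) (_ : n.+1 <= q.+1)%N) ?ltnS ?leq_maxr//=.
  by rewrite lerDl sum_sqr_ge0.
have mq : (m.+1 <= q.+1)%N by rewrite ltnS leq_maxl.
rewrite -[leLHS]ger0_norm ?l2_ge0// -sqrtr_sqr ler_wsqrtr//.
rewrite /N (l2_cat _ (leq0n m.+1) mq); apply: lerD.
  rewrite ler_sqr ?nnegrE ?l2_ge0 ?addr_ge0 ?mulr_ge0//.
  apply: le_trans (l2D _ _ (leq0n _)) _; apply: lerD; last exact: NC.
  exact: le_trans (sup_space_le S m) S1.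
rewrite ler_sqr ?nnegrE ?l2_ge0 ?addr_ge0 ?(ltW tau0)//.
apply: le_trans (l2D _ _ mq) _; apply: lerD.
  rewrite -ler_sqr ?nnegrE ?l2_ge0 ?(ltW tau0)//.
  have := l2_cat (p ^~ (T S)) (leq0n m.+1) mq.
  have := sup_space_le S q; have := sup_space_le S m.
  have := l2_ge0 (p ^~ (T S)) 0 q.+1; have := l2_ge0 (p ^~ (T S)) 0 m.+1.
  rewrite -[interpolation_norms m _]/(N m (T S)) -[interpolation_norms q _]/(N q (T S)).
  rewrite -!/(N _ _); move: Sm S1 (normr_ge0 S).
  set u := N m _; set v := N q _; set w := `|S|; set l := l2 _ _ _.
  move=> h1 h2 h3 h4 h5 h6 h7 h8; nra.
apply: le_trans (sup_space_le z q).
rewrite -[interpolation_norms q _]/(N q (T z)) -ler_sqr ?nnegrE ?l2_ge0//.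
by rewrite /N (l2_cat _ (leq0n m.+1) mq) lerDr sqr_ge0.
Qed.

Lemma interpolation_space_weakly_closed (G : set_system Z) (r : R) (x : X) :
  UltraFilter G -> (\forall z \near G, `|z| <= r) ->
  (forall g : dual X, (fun z => g (T z)) @ G --> g x) -> exists z, T z = x.
Proof.
move=> GU Gr Gx; have [|z zx _] := @sup_space_ex _ _ interpolation_norms x r; last by exists z.
move=> n; have [C C0 NC] := N_continuous n.
apply: (seminorm_weak_lsc (N_seminorm n) C0 NC GU _ Gx).
by apply: filterS Gr => z; apply: le_trans (@sup_space_le _ _ interpolation_norms z n).
Qed.

Hypothesis Wpat : forall e, 0 < e -> exists n, ~ pattern W n e.

Lemma interpolation_space_no_pattern (r e : R) : 0 < e ->
  exists n, ~ pattern (T @` [set z | `|z| <= r]) n e.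
Proof.
move=> e0; have e4 : 0 < e / 4 by rewrite divr_gt0.
have [s s0 sP] := interpolation_space_approx r e4.
have [|n nW] := Wpat (e := e / (2 * s)); first by rewrite divr_gt0// mulr_gt0.
exists n => pat; apply: nW; apply: pattern_approx pat => // _ [z zr <-].
exact: sP.
Qed.

Lemma interpolation_space_bound (r : R) : exists B, forall a,
  (T @` [set z | `|z| <= r]) a -> `|a| <= B.
Proof.
have [C C0 TC] := sup_val_bound interpolation_norms.
exists (C * r) => _ [z zr <-]; apply: le_trans (TC z) _.
by rewrite ler_pM2l.
Qed.

Hypothesis cX : rapid_complete X.

Lemma interpolation_space_reflexive : reflexive_space Z.
Proof.
apply: (@reflexive_by_factorization _ _ _ T).
- move=> r; have [B TB] := interpolation_space_bound r.
  apply: (no_pattern_rel_weakly_compact cX TB) => e e0.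
  exact: interpolation_space_no_pattern.
- move=> f e e0; apply: smooth_functional_bound => // S tau.
  exact: interpolation_space_smooth.
- move=> G r x GU; exact: interpolation_space_weakly_closed.
Qed.

Lemma interpolation_space_super : super_weakly_compact_operator T.
Proof.
(* The infimum in the quotient norm gives a class of the unit ball a representative of norm below
   2. *)
move=> I U _; pose A := T @` [set z | `|z| <= 2].
have [B AB] := interpolation_space_bound 2.
apply: (@rel_weakly_compact_subset _ _ _ (set_ultrapower U A)).
  move=> _ [c c1 <-]; have [x xc x2] := quotient_norm_adherent c ltr01.
  exists (map_family T x); last by rewrite -xc -ultrapower_mapE.
  move=> i; exists (x i) => //=; apply: le_trans (sup_norm_ub x i) (ltW _).
  apply: lt_le_trans x2 _; rewrite /unit_ball /= in c1.
  by rewrite -[quotient_norm c]/(`|c|); lra.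
have UAB c : set_ultrapower U A c -> `|c| <= `|B|.
  move=> [x xA <-]; apply: le_trans (ultra_norm_lb _ _) _.
  apply: sup_norm_lub => // i; exact: le_trans (AB _ (xA i)) (ler_norm _).
apply: (no_pattern_rel_weakly_compact (rapid_complete_ultrapower cX) UAB) => e e0.
have e2 : 0 < e / 2 by rewrite divr_gt0.
have [n nA] := interpolation_space_no_pattern 2 e2.
by exists n => /(pattern_ultrapower e0).
Qed.

End InterpolationSpace.

Lemma super_weakly_compact_image {R : realType} {Z X : normedModType R}
    (T : bounded_operator Z X) (K : set X) :
  super_weakly_compact_operator T -> K `<=` T @` unit_ball Z ->
  weakly_closed K -> super_weakly_compact K.
Proof.
move=> Tc KT cK; split=> // I U infI; apply: rel_weakly_compact_subset (Tc I U infI).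
move=> _ [x xK <-]; have /choice[z zP] i : exists z, `|z| <= 1 /\ T z = x i.
  by have [z z1 zx] := KT _ (xK i); exists z.
pose zf := mk_bounded_family (fun i => (zP i).1).
exists (ultraclass U zf).
  rewrite /unit_ball /=; apply: le_trans (ultra_norm_lb _ _) _.
  by apply: sup_norm_lub => // i; exact: (zP i).1.
rewrite -[LHS]/(ultrapower_map T (ultraclass U zf)) ultrapower_mapE; congr (ultraclass U _).
by apply: bounded_family_eq => i; exact: (zP i).2.
Qed.

Theorem theorem2p3 (R : realType) (X : completeNormedModType R) (K : set X) :
  weakly_closed K ->
  (super_weakly_compact K <->
   exists (Z : completeNormedModType R) (T : bounded_operator Z X),
     [/\ reflexive_space Z,
         super_weakly_compact_operator T &
         K `<=` T @` unit_ball Z]).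
Proof.
move=> cK; split=> [[_ Kc]|[Z [T [_ Tc KT]]]]; last exact: super_weakly_compact_image KT cK.
have natc (U : free_ultrafilter nat) : relatively_weakly_compact (set_ultrapower U K).
  by apply: Kc; exact: infinite_nat.
have [U _] := nat_free_ultrafilter.
have [M [M0 KM]] := ultra_rel_weakly_compact_bounded (natc U).
have cX : rapid_complete X := @rapid_complete_banach R X.
have W0 := @bipolar0 R X K; have Wac := @bipolar_abs_convex R X K.
have WM := bipolar_bound M0 KM; have Wpat := bipolar_no_pattern natc.
pose N := interpolation_norms W0 Wac WM.
exists (banach_of (rapid_complete_sup_space (N := N) cX)), (sup_embedding N); split.
- exact: (interpolation_space_reflexive W0 Wac WM Wpat cX).
- exact: (interpolation_space_super W0 Wac WM Wpat cX).
- by move=> x Kx; apply: (interpolation_space_contains W0 Wac WM); exact: sub_bipolar.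
Qed.
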